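(* Let $\varepsilon\in\{0,1\}$ and let $n\geq 1$ be an integer. Put $m=2n-\varepsilon$ and $\ell=3n+1-\varepsilon$ (so that $2\ell-1=6n+(-1)^{\varepsilon}$). For every integer $b$ with $0\leq b\leq 2n+1-\varepsilon$, $$\sum_{i,j_1,\dots,j_{m}\geq 0}\frac{q^{Q(i,j_1,\dots,j_m)+R_b(i,j_1,\dots,j_m)}}{(q^2;q^2)_i\,(q^2;q^2)_{j_1}\cdots(q^2;q^2)_{j_{m}}}=\chi_{A^{(2)}_{2\ell-1}}(\Lambda'_{n+b}),$$ where, with $J_k=j_k+j_{k+1}+\dots+j_{m}$ for $1\leq k\leq m$, $$Q(i,j_1,\dots,j_m)=(n+1-\varepsilon)i^2+2(J_1^2+\dots+J_m^2)+2i(J_1+\dots+J_m),$$ $$R_b(i,j_1,\dots,j_m)=(b-1+\varepsilon)i+2\sum_{k=m+2-b}^{m}J_k$$ (the last sum being empty, hence $0$, when $b=0$ or $b=1$), and where for $1\leq c\leq \ell$ $$\chi_{A^{(2)}_{2\ell-1}}(\Lambda'_c)=\frac{(q^{2\ell+2};q^{2\ell+2})_\infty}{(q^2;q^2)_\infty}\cdot\frac{(q^{2c},q^{2\ell+2-2c};q^{2\ell+2})_\infty}{(q^{c},q^{2\ell+2-c};q^{2\ell+2})_\infty}.$$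
   Context: The $q$-Pochhammer symbol is $(a_1,\dots,a_r;q)_N=\prod_{k=1}^{r}\prod_{c=1}^{N}(1-a_kq^{c-1})$ for $N\in\mathbb{Z}_{\geq0}\sqcup\{\infty\}$. The identity is one of formal power series in $q$ (equivalently, of analytic functions for $|q|<1$). The indices $i,j_1,\dots,j_m$ range over all nonnegative integers. Representation-theoretic meaning of the right-hand side: for $\ell\geq3$, $\chi_{A^{(2)}_{2\ell-1}}(\Lambda'_c)$ is the principal character of the level 2 standard module of the affine Lie algebra of type $A^{(2)}_{2\ell-1}$ with highest weight $\Lambda'_c=(\delta_{c,0}+\delta_{c,1})\Lambda_0+\Lambda_c$, where $\Lambda_0,\dots,\Lambda_\ell$ are the fundamental weights (in the Dynkin diagram, nodes $0$ and $1$ are both attached to node $2$, followed by the chain $2,3,\dots,\ell-1,\ell$ with a double bond between $\ell-1$ and $\ell$ whose arrow points to $\ell-1$). For $1\leq c\leq\ell$ it is given by the infinite product displayed in the claim, which is used here as its definition. *)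

(* Defs.v *)
From HB Require Import structures.
From mathcomp Require Import all_boot all_order all_algebra.
From mathcomp Require Import boolp classical_sets.
From mathcomp Require Import zify ring lra.

Set Implicit Arguments.
Unset Strict Implicit.
Unset Printing Implicit Defensive.
Set Warnings "-redundant-canonical-projection".

Import Order.TTheory GRing.Theory Num.Theory.

Local Open Scope ring_scope.

Record fps (R : Type) := Fps { fcoef : nat -> R }.

Notation "{ 'fps' R }" := (fps R) (at level 0, format "{ 'fps'  R }").

Lemma fpsP (R : Type) (f g : {fps R}) : fcoef f =1 fcoef g <-> f = g.
Proof.
split=> [|->//]; case: f g => [f] [g] /= fg.
by congr Fps; apply: funext.
Qed.

HB.instance Definition _ (R : Type) := gen_eqMixin {fps R}.
HB.instance Definition _ (R : Type) := gen_choiceMixin {fps R}.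

Section Zmodule.
Variable R : zmodType.
Implicit Types f g h : {fps R}.

Definition fps_zero : {fps R} := Fps (fun=> 0).
Definition fps_opp f : {fps R} := Fps (fun k => - fcoef f k).
Definition fps_add f g : {fps R} := Fps (fun k => fcoef f k + fcoef g k).

Fact fps_addA : associative fps_add.
Proof. by move=> f g h; apply/fpsP => k /=; rewrite addrA. Qed.

Fact fps_addC : commutative fps_add.
Proof. by move=> f g; apply/fpsP => k /=; rewrite addrC. Qed.

Fact fps_add0 : left_id fps_zero fps_add.
Proof. by move=> f; apply/fpsP => k /=; rewrite add0r. Qed.

Fact fps_addN : left_inverse fps_zero fps_opp fps_add.
Proof. by move=> f; apply/fpsP => k /=; rewrite addNr. Qed.

HB.instance Definition _ :=
  GRing.isZmodule.Build {fps R} fps_addA fps_addC fps_add0 fps_addN.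

Lemma fcoef0 k : fcoef (0 : {fps R}) k = 0. Proof. by []. Qed.

Lemma fcoefN f k : fcoef (- f) k = - fcoef f k. Proof. by []. Qed.

Lemma fcoefD f g k : fcoef (f + g) k = fcoef f k + fcoef g k.
Proof. by []. Qed.

Lemma fcoef_sum (I : Type) (r : seq I) (P : pred I) (F : I -> {fps R}) k :
  fcoef (\sum_(i <- r | P i) F i) k = \sum_(i <- r | P i) fcoef (F i) k.
Proof. by apply: (big_morph (fun f : {fps R} => fcoef f k)). Qed.

End Zmodule.

Section Ring.
Variable R : comNzRingType.
Implicit Types f g h : {fps R}.

Definition fps_one : {fps R} := Fps (fun k => (k == 0%N)%:R).
Definition fps_mul f g : {fps R} :=
  Fps (fun k => \sum_(i < k.+1) fcoef f i * fcoef g (k - i)%N).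

Let trunc N f : {poly R} := \poly_(i < N.+1) fcoef f i.

Let coef_trunc N f k : (k <= N)%N -> (trunc N f)`_k = fcoef f k.
Proof. by move=> kN; rewrite coef_poly ltnS kN. Qed.

Let coef_truncM N (p1 p2 : {poly R}) f g k :
    (forall i, (i <= N)%N -> p1`_i = fcoef f i) ->
    (forall i, (i <= N)%N -> p2`_i = fcoef g i) ->
  (k <= N)%N -> (p1 * p2)`_k = fcoef (fps_mul f g) k.
Proof.
move=> H1 H2 kN; rewrite coefM /=; apply: eq_bigr => i _.
by rewrite H1 ?H2 //; have := ltn_ord i; lia.
Qed.

Fact fps_mulA : associative fps_mul.
Proof.
move=> f g h; apply/fpsP => k.
have tr u i : (i <= k)%N -> (trunc k u)`_i = fcoef u i by exact: coef_trunc.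
have trM u v i : (i <= k)%N ->
    (trunc k u * trunc k v)`_i = fcoef (fps_mul u v) i.
  by move=> ik; apply: (@coef_truncM k) => // ? ?; apply: tr.
rewrite -(@coef_truncM k (trunc k f) (trunc k g * trunc k h)) //;
  do ?by move=> *; first [apply: tr | apply: trM].
rewrite -(@coef_truncM k (trunc k f * trunc k g) (trunc k h)) //;
  do ?by move=> *; first [apply: tr | apply: trM].
by rewrite mulrA.
Qed.

Fact fps_mulC : commutative fps_mul.
Proof.
move=> f g; apply/fpsP => k.
rewrite -(@coef_truncM k (trunc k f) (trunc k g)) //; do ?exact: coef_trunc.
rewrite -(@coef_truncM k (trunc k g) (trunc k f)) //; do ?exact: coef_trunc.
by rewrite mulrC.
Qed.

Fact fps_mul1 : left_id fps_one fps_mul.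
Proof.
move=> f; apply/fpsP => k /=; rewrite big_ord_recl /= subn0 mul1r.
by rewrite big1 ?addr0 // => i _; rewrite mul0r.
Qed.

Fact fps_mulDl : left_distributive fps_mul (@fps_add R).
Proof.
move=> f g h; apply/fpsP => k /=; rewrite -big_split /=.
by apply: eq_bigr => i _; rewrite mulrDl.
Qed.

Fact fps_one_neq0 : fps_one != 0.
Proof.
apply/eqP => /fpsP /(_ 0%N) /= /eqP; by rewrite oner_eq0.
Qed.

HB.instance Definition _ :=
  GRing.Zmodule_isComNzRing.Build {fps R}
    fps_mulA fps_mulC fps_mul1 fps_mulDl fps_one_neq0.

Lemma fcoef1 k : fcoef (1 : {fps R}) k = (k == 0%N)%:R. Proof. by []. Qed.

Lemma fcoefM f g k :
  fcoef (f * g) k = \sum_(i < k.+1) fcoef f i * fcoef g (k - i)%N.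
Proof. by []. Qed.

Lemma fcoef0M f g : fcoef (f * g) 0 = fcoef f 0 * fcoef g 0.
Proof. by rewrite fcoefM big_ord1. Qed.

Definition fpsX : {fps R} := Fps (fun k => (k == 1%N)%:R).

Lemma fcoefXn n k : fcoef (fpsX ^+ n) k = (k == n)%:R.
Proof.
elim: n k => [|n IHn] k; first by rewrite expr0 fcoef1.
rewrite exprS fcoefM; case: k => [|k]; first by rewrite big_ord1 /= mul0r.
rewrite 2!big_ord_recl /= mul0r add0r mul1r IHn subSS subn0 eqSS.
by rewrite big1 ?addr0 // => i _; rewrite /bump /= mul0r.
Qed.

End Ring.

Section UnitRing.
Variable R : comUnitRingType.
Implicit Types f g h : {fps R}.

(* The list of the first n + 1 coefficients of f^-1. *)
Fixpoint fps_inv_seq f (n : nat) : seq R :=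
  if n is n'.+1 then
    let s := fps_inv_seq f n' in
    rcons s (- (fcoef f 0)^-1 * \sum_(i < n'.+1) s`_i * fcoef f (n'.+1 - i)%N)
  else [:: (fcoef f 0)^-1].

(* Outside the units the inverse is the identity, as in every unitRingType. *)
Definition fps_unit : pred {fps R} := fun f => fcoef f 0 \is a GRing.unit.
Definition fps_inv f : {fps R} :=
  if fps_unit f then Fps (fun k => (fps_inv_seq f k)`_k) else f.

Let size_inv_seq f n : size (fps_inv_seq f n) = n.+1.
Proof. by elim: n => //= n IHn; rewrite size_rcons IHn. Qed.

Let nth_inv_seq f n k : (k <= n)%N ->
  (fps_inv_seq f n)`_k = (fps_inv_seq f k)`_k.
Proof.
elim: n => [|n IHn]; first by case: k.
rewrite leq_eqVlt => /orP[/eqP -> //|kn].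
by rewrite /= nth_rcons size_inv_seq kn IHn.
Qed.

Fact fps_mulVr : {in fps_unit, left_inverse 1 fps_inv *%R}.
Proof.
move=> f; rewrite -topredE /= => uf; apply/fpsP => k.
rewrite fcoefM fcoef1 /fps_inv uf /=.
case: k => [|k]; first by rewrite big_ord1 /= mulVr.
rewrite big_ord_recr /= subnn nth_rcons size_inv_seq ltnn eqxx.
rewrite mulrAC mulNr mulVr // mulN1r.
rewrite [X in _ - X](_ : _ =
  \sum_(i < k.+1) (fps_inv_seq f i)`_i * fcoef f (k.+1 - i)%N) ?subrr //.
by apply: eq_bigr => i _; rewrite nth_inv_seq // -ltnS.
Qed.

Fact fps_unitP f g : g * f = 1 -> fps_unit f.
Proof.
move=> /fpsP /(_ 0%N); rewrite fcoef0M fcoef1 /= => gf.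
by apply/unitrP; exists (fcoef g 0); rewrite [_ * fcoef g 0]mulrC gf.
Qed.

Fact fps_inv_out : {in [predC fps_unit], fps_inv =1 id}.
Proof.
by move=> f nuf; rewrite /fps_inv ifN //; move: nuf; rewrite inE.
Qed.

HB.instance Definition _ :=
  GRing.ComNzRing_hasMulInverse.Build {fps R} fps_mulVr fps_unitP fps_inv_out.

Lemma fps_unitE f : (f \is a GRing.unit) = (fcoef f 0 \is a GRing.unit).
Proof. by []. Qed.

End UnitRing.

Definition fps_cvg (R : Type) (u : nat -> {fps R}) (f : {fps R}) :=
  forall k, exists N, forall n, (N <= n)%N -> fcoef (u n) k = fcoef f k.

(* Equal to 0 when u does not converge. *)
Definition fps_lim (R : zmodType) (u : nat -> {fps R}) : {fps R} :=
  xget 0 [set f | fps_cvg u f]%classic.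

(* Unconditional summability: every coefficient of the finite partial sums is
   eventually constant along the directed set of finite subsets of I. *)
Definition fps_has_sum (R : zmodType) (I : eqType)
    (F : I -> {fps R}) (f : {fps R}) :=
  forall k, exists s0 : seq I, forall s : seq I, uniq s -> {subset s0 <= s} ->
    fcoef (\sum_(i <- s) F i) k = fcoef f k.

Lemma fps_cvg_unique (R : Type) (u : nat -> {fps R}) f g :
  fps_cvg u f -> fps_cvg u g -> f = g.
Proof.
move=> uf ug; apply/fpsP => k; have [M HM] := uf k; have [N HN] := ug k.
by rewrite -(HM (maxn M N)) ?leq_maxl // HN // leq_maxr.
Qed.

Lemma fps_cvg_lim (R : zmodType) (u : nat -> {fps R}) f :
  fps_cvg u f -> fps_lim u = f.
Proof.
move=> uf; rewrite /fps_lim; case: xgetP => [g _ ug|/(_ f)] //.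
exact: fps_cvg_unique ug uf.
Qed.

Lemma fps_has_sum_unique (R : zmodType) (I : eqType) (F : I -> {fps R}) f g :
  fps_has_sum F f -> fps_has_sum F g -> f = g.
Proof.
move=> Ff Fg; apply/fpsP => k; have [s Hs] := Ff k; have [t Ht] := Fg k.
rewrite -(Hs (undup (s ++ t))) ?undup_uniq ?(Ht (undup (s ++ t))) ?undup_uniq //.
- by move=> x xt; rewrite mem_undup mem_cat xt orbT.
- by move=> x xs; rewrite mem_undup mem_cat xs.
Qed.

Section Pochhammer.
Variable R : comUnitRingType.
Implicit Types (a q : {fps R}) (s : seq {fps R}).

Definition qpoch s q (N : nat) : {fps R} :=
  \prod_(a <- s) \prod_(1 <= c < N.+1) (1 - a * q ^+ c.-1).

Definition qpoch_oo s q : {fps R} :=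
  \prod_(a <- s) fps_lim (fun N => \prod_(1 <= c < N.+1) (1 - a * q ^+ c.-1)).

Let fcoefXn_lt q k n : fcoef q 0 = 0 -> (k < n)%N -> fcoef (q ^+ n) k = 0.
Proof.
move=> q0; elim: n k => // n IHn k kn.
rewrite exprS fcoefM big_ord_recl q0 mul0r add0r big1 // => i _.
by rewrite IHn ?mulr0 //= /bump /=; have := ltn_ord i; lia.
Qed.

Lemma qpoch1_cvg a q : fcoef q 0 = 0 ->
  fps_cvg (fun N => \prod_(1 <= c < N.+1) (1 - a * q ^+ c.-1))
    (fps_lim (fun N => \prod_(1 <= c < N.+1) (1 - a * q ^+ c.-1))).
Proof.
move=> q0; set u := (fun N : nat => _).
have step k N : (k < N)%N -> fcoef (u N.+1) k = fcoef (u N) k.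
  move=> kN; have -> : u N.+1 = u N * (1 - a * q ^+ N) by rewrite /u big_nat_recr.
  rewrite mulrBr mulr1 fcoefD fcoefN.
  rewrite [fcoef (_ * (a * _)) k]fcoefM big1 ?subr0 // => i _.
  rewrite fcoefM big1 ?mulr0 // => j _.
  by rewrite fcoefXn_lt ?mulr0 //; have := ltn_ord i; have := ltn_ord j; lia.
suff cu : fps_cvg u (Fps (fun k => fcoef (u k.+1) k)).
  by rewrite (fps_cvg_lim cu).
move=> k; exists k.+1 => n /subnKC <-; elim: (n - _)%N => [|d IHd].
  by rewrite addn0.
by rewrite addnS step //; lia.
Qed.

Lemma qpoch_unit s q N :
  all (fun a => fcoef a 0 == 0) s -> qpoch s q N \is a GRing.unit.
Proof.
move=> /allP s0; rewrite /qpoch big_seq; apply: rpred_prod => a /s0 /eqP a0.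
apply: rpred_prod => c _.
by rewrite fps_unitE fcoefD fcoefN fcoef0M a0 mul0r subr0 fcoef1 unitr1.
Qed.

Lemma qpoch_oo_unit s q : fcoef q 0 = 0 ->
  all (fun a => fcoef a 0 == 0) s -> qpoch_oo s q \is a GRing.unit.
Proof.
move=> q0 /allP s0; rewrite /qpoch_oo big_seq.
apply: rpred_prod => a /s0 a0; rewrite fps_unitE.
have [N HN] := qpoch1_cvg a q0 0; rewrite -(HN N) //.
have := @qpoch_unit [:: a] q N; rewrite /qpoch big_seq1 fps_unitE; apply.
by rewrite /= a0.
Qed.

End Pochhammer.

Notation "''q'" := (fpsX int) (at level 0, only parsing) : ring_scope.

(* The index j_k, 1 <= k <= m, is stored as the value of j at k - 1. *)
Definition Jsum (m : nat) (j : {ffun 'I_m -> nat}) (k : nat) : nat :=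
  (\sum_(p < m | k <= p.+1) j p)%N.

Definition Qexp (n e m i : nat) (j : {ffun 'I_m -> nat}) : int :=
  (n%:Z + 1 - e%:Z) * i%:Z ^+ 2
  + 2 * (\sum_(1 <= k < m.+1) (Jsum j k)%:Z ^+ 2)
  + 2 * i%:Z * (\sum_(1 <= k < m.+1) (Jsum j k)%:Z).

(* For b <= m + 1 the truncated difference m + 2 - b is exact. *)
Definition Rexp (b e m i : nat) (j : {ffun 'I_m -> nat}) : int :=
  (b%:Z - 1 + e%:Z) * i%:Z
  + 2 * (\sum_((m + 2 - b)%N <= k < m.+1) (Jsum j k)%:Z).

(* The linear form Rexp may be negative, but the total exponent never is, so
   the integer power of 'q occurring in qterm is an ordinary power. *)
Lemma QRexp_ge0 (n e b m i : nat) (j : {ffun 'I_m -> nat}) :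
  (1 <= n)%N -> (e <= 1)%N -> 0 <= Qexp n e i j + Rexp b e i j.
Proof.
move=> n1 e1; rewrite /Qexp /Rexp.
have S0 (a c : nat) : 0 <= \sum_(a <= k < c) (Jsum j k)%:Z.
  by apply: sumr_ge0.
have S2 : 0 <= \sum_(1 <= k < m.+1) (Jsum j k)%:Z ^+ 2.
  by apply: sumr_ge0 => k _; apply: sqr_ge0.
have := S0 1%N m.+1; have := S0 (m + 2 - b)%N m.+1; move: S2.
set A := \sum_(_ <= _ < _) _; set B := \sum_(_ <= _ < _) _.
set C := \sum_(_ <= _ < _) _ => A0 B0 C0.
have iC : 0 <= i%:Z * C by apply: mulr_ge0.
have i2 : i%:Z <= i%:Z ^+ 2 by rewrite expr2; nia.
have bi : 0 <= b%:Z * i%:Z by apply: mulr_ge0.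
have : 0 <= (n%:Z - 1) * i%:Z ^+ 2 by apply: mulr_ge0; lia.
have : 0 <= (1 - e%:Z) * (i%:Z ^+ 2 - i%:Z) by apply: mulr_ge0; lia.
by nia.
Qed.

Definition qterm (n e b m : nat) (x : nat * {ffun 'I_m -> nat}) : {fps int} :=
  let: (i, j) := x in
  'q ^ (Qexp n e i j + Rexp b e i j)
  / (qpoch [:: 'q ^+ 2] ('q ^+ 2) i
     * \prod_(p < m) qpoch [:: 'q ^+ 2] ('q ^+ 2) (j p)).

(* Product form of the principal character of the level 2 standard module of
   type A^(2)_(2l-1) with highest weight Lambda'_c, for 1 <= c <= l. *)
Definition chi_A2odd (l c : nat) : {fps int} :=
  let Q := 'q ^+ (2 * l + 2) in
  (qpoch_oo [:: Q] Q / qpoch_oo [:: 'q ^+ 2] ('q ^+ 2))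
  * (qpoch_oo [:: 'q ^+ (2 * c); 'q ^+ (2 * l + 2 - 2 * c)] Q
     / qpoch_oo [:: 'q ^+ c; 'q ^+ (2 * l + 2 - c)] Q).

(* Main.v *)
(** Put p = q^2. Peeling off j_m, and evaluating the resulting inner finite sum
    with the q-Chu-Vandermonde-type identity
    [sum_r (-1)^r p^(r choose 2) [s, r]_p (z; p)_(s-r) = (-z)^s p^(s choose 2)],
    shows by induction on m that (p; p)_oo times the sum over j_1, ..., j_m is a
    single alternating sum over r. Its base case is Euler's pentagonal number
    theorem, obtained by telescoping. Grouping what remains according to
    t = i + 2 r leaves, for each t, a polynomial of Schur type
    [sum_r (-1)^r p^(..) [t - r, r]_p], which vanishes for t = 2 mod 3 and is a
    signed monomial otherwise. The surviving terms form the series of the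
    quintuple product, which is evaluated from Jacobi's triple product. *)

Require Import Defs.
From mathcomp Require Import all_boot all_order all_algebra.
From mathcomp Require Import boolp classical_sets.
From mathcomp Require Import zify ring.

Set Implicit Arguments.
Unset Strict Implicit.
Unset Printing Implicit Defensive.

Import Order.TTheory GRing.Theory Num.Theory.

Local Open Scope ring_scope.

(** * Sums of power series *)

(** The parameter [b] is what lets the induction on m close. The last index enters every J_k, so
    peeling it off shifts all of them equally: i becomes i + 2 j_m, and [b] drops together with m.
    In the alternating sum the factor [1 - p ^+ _] joins the term r of a bilateral series to its
    mirror image at -r-i-1. It depends only on i + 2 r, and on k and b only through their
    difference, so it survives each regrouping unchanged. Grouping by t = i + 2 r completes the
    square: the exponent of q becomes n t^2 + b t plus a part free of n and b, so one Schur
    polynomial for each value of [e] serves all n and b. The same factor finally unfolds a sum over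
    u >= 0 into one over all integers. As q is not invertible, integer powers of q may be combined
    only when their exponents are nonnegative. Hence the explicit lower bounds on quadratic
    exponents, which also give summability. *)

Section Order.
Variable R : comNzRingType.
Implicit Types f g : {fps R}.

(** Membership in the ideal generated by the [n]-th power of the variable; limits are handled below
    as congruences modulo these ideals. *)
Definition fps_ord_ge n f := forall k, (k < n)%N -> fcoef f k = 0.

Lemma ord_ge0n f : fps_ord_ge 0 f. Proof. by []. Qed.

Lemma ord_ge0 n : fps_ord_ge n (0 : {fps R}). Proof. by []. Qed.

Lemma ord_geW n m f : (m <= n)%N -> fps_ord_ge n f -> fps_ord_ge m f.
Proof. by move=> mn nf k km; apply: nf; exact: leq_trans km mn. Qed.

Lemma ord_geD n f g : fps_ord_ge n f -> fps_ord_ge n g -> fps_ord_ge n (f + g).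
Proof. by move=> nf ng k kn; rewrite fcoefD nf // ng // addr0. Qed.

Lemma ord_geN n f : fps_ord_ge n f -> fps_ord_ge n (- f).
Proof. by move=> nf k kn; rewrite fcoefN nf // oppr0. Qed.

Lemma ord_geM n m f g :
  fps_ord_ge n f -> fps_ord_ge m g -> fps_ord_ge (n + m) (f * g).
Proof.
move=> nf mg k knm; rewrite fcoefM big1 // => i _.
have [iltn|nlei] := ltnP i n; first by rewrite nf // mul0r.
by rewrite mg ?mulr0 //; have := ltn_ord i; lia.
Qed.

Lemma ord_geMl n f g : fps_ord_ge n g -> fps_ord_ge n (f * g).
Proof. by move=> ng; rewrite -[n]add0n; apply: ord_geM. Qed.

Lemma ord_geMr n f g : fps_ord_ge n f -> fps_ord_ge n (f * g).
Proof. by rewrite mulrC; apply: ord_geMl. Qed.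

Lemma ord_geX n f : fcoef f 0 = 0 -> fps_ord_ge n (f ^+ n).
Proof.
move=> f0; elim: n => // n IHn; rewrite exprS -add1n; apply: ord_geM => //.
by case.
Qed.

Lemma ord_ge_eq f g : (forall n, fps_ord_ge n (f - g)) -> f = g.
Proof.
move=> fg; apply/fpsP => k; apply/eqP; rewrite -subr_eq0 -fcoefN -fcoefD.
by rewrite (fg k.+1).
Qed.

Lemma ord_ge_sum (I : Type) (r : seq I) (P : pred I) (F : I -> {fps R}) n :
  (forall i, P i -> fps_ord_ge n (F i)) ->
  fps_ord_ge n (\sum_(i <- r | P i) F i).
Proof.
by move=> FP; elim/big_ind: _ => //; apply: ord_geD.
Qed.

End Order.

Section Summation.
Variable R : comNzRingType.
Implicit Types I J : choiceType.

Definition summable I (F : I -> {fps R}) :=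
  forall k, exists s : seq I, forall x, x \notin s -> fcoef (F x) k = 0.

(* Equal to 0 when F has no unconditional sum. *)
Definition tsum I (F : I -> {fps R}) : {fps R} :=
  xget 0 [set f | fps_has_sum F f]%classic.

Lemma has_sum_tsum I (F : I -> {fps R}) f : fps_has_sum F f -> tsum F = f.
Proof.
move=> Ff; rewrite /tsum; case: xgetP => [g _ Fg|/(_ f)] //.
exact: fps_has_sum_unique Fg Ff.
Qed.

Lemma big_supp (V : nmodType) I (s t : seq I) (F : I -> V) :
  uniq s -> uniq t -> {subset s <= t} ->
  (forall x, x \in t -> x \notin s -> F x = 0) ->
  \sum_(x <- t) F x = \sum_(x <- s) F x.
Proof.
move=> us ut st F0; rewrite (bigID (mem s)) /= [X in _ + X]big_seq_cond.
rewrite [X in _ + X]big1 => [|x /andP[]]; last exact: F0.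
rewrite addr0 -big_filter; apply: perm_big; apply: uniq_perm => //.
  exact: filter_uniq.
by move=> x; rewrite mem_filter; case: (boolP (x \in s)) => //= /st.
Qed.

Lemma has_sum_coef I (F : I -> {fps R}) f k s : fps_has_sum F f -> uniq s ->
  (forall x, x \notin s -> fcoef (F x) k = 0) ->
  fcoef f k = \sum_(x <- s) fcoef (F x) k.
Proof.
move=> /(_ k)[s0 Hs0] us F0; rewrite -(Hs0 (undup (s0 ++ s))) ?undup_uniq //.
  rewrite fcoef_sum; apply: big_supp; rewrite ?undup_uniq //.
    by move=> x xs; rewrite mem_undup mem_cat xs orbT.
  by move=> x _; apply: F0.
by move=> x xs; rewrite mem_undup mem_cat xs.
Qed.

Lemma has_sumP I (F : I -> {fps R}) f :
  (forall k, exists s, [/\ uniq s, (forall x, x \notin s -> fcoef (F x) k = 0)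
     & fcoef f k = \sum_(x <- s) fcoef (F x) k]) -> fps_has_sum F f.
Proof.
move=> H k; have [s [us F0 ->]] := H k; exists s => t ut st.
by rewrite fcoef_sum; apply: big_supp => // x _; apply: F0.
Qed.

(** Adjoining one index [x] to a list on which the coefficient is already stable cannot change it,
    so that coefficient of [F x] is zero. *)
Lemma has_sum_summable I (F : I -> {fps R}) f :
  fps_has_sum F f -> summable F.
Proof.
move=> Ff k; have [s0 Hs0] := Ff k; exists (undup s0) => x xs.
have := Hs0 (x :: undup s0); rewrite /= xs undup_uniq big_cons fcoefD.
rewrite Hs0 ?undup_uniq //; last by move=> y; rewrite mem_undup.
move=> H; apply: (addIr (fcoef f k)); rewrite add0r H // => y.
by rewrite inE mem_undup => ->; rewrite orbT.
Qed.

Lemma summable_has_sum I (F : I -> {fps R}) :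
  summable F -> fps_has_sum F (tsum F).
Proof.
move=> sF; pose s k := undup (projT1 (cid (sF k))).
suff H : fps_has_sum F (Fps (fun k => \sum_(x <- s k) fcoef (F x) k)).
  by rewrite (has_sum_tsum H).
apply: has_sumP => k; exists (s k); split=> //; first exact: undup_uniq.
by move=> x; rewrite mem_undup; case: (cid (sF k)) => t Ht; apply: Ht.
Qed.

Lemma tsum_coef I (F : I -> {fps R}) k s : summable F -> uniq s ->
  (forall x, x \notin s -> fcoef (F x) k = 0) ->
  fcoef (tsum F) k = \sum_(x <- s) fcoef (F x) k.
Proof. by move=> /summable_has_sum; apply: has_sum_coef. Qed.

Lemma eq_tsum I (F G : I -> {fps R}) : F =1 G -> tsum F = tsum G.
Proof. by move=> /funext ->. Qed.

Lemma eq_summable I (F G : I -> {fps R}) : F =1 G -> summable F -> summable G.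
Proof. by move=> /funext ->. Qed.

Lemma summable_ord I (w : I -> nat) (F : I -> {fps R}) :
  (forall k, exists s : seq I, forall x, (w x <= k)%N -> x \in s) ->
  (forall x, fps_ord_ge (w x) (F x)) -> summable F.
Proof.
move=> fw Fw k; have [s Hs] := fw k; exists s => x xs; apply: Fw.
by rewrite ltnNge; apply: contra xs; apply: Hs.
Qed.

Lemma summable_nat (F : nat -> {fps R}) :
  (forall n, fps_ord_ge n (F n)) -> summable F.
Proof.
apply: summable_ord => k; exists (iota 0 k.+1) => x xk.
by rewrite mem_iota.
Qed.

Lemma summable_natnat (F : nat * nat -> {fps R}) :
  (forall x, fps_ord_ge (maxn x.1 x.2) (F x)) -> summable F.
Proof.
apply: summable_ord => k.
exists [seq (x, y) | x <- iota 0 k.+1, y <- iota 0 k.+1] => -[x y] xyk.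
by apply: (allpairs_f pair); rewrite mem_iota; move: xyk => /=; lia.
Qed.

Lemma summable_int (F : int -> {fps R}) :
  (forall z, fps_ord_ge `|z|%N (F z)) -> summable F.
Proof.
apply: summable_ord => k.
exists (map Posz (iota 0 k.+1) ++ map Negz (iota 0 k.+1)) => -[] x xk.
  by rewrite mem_cat map_f // mem_iota; lia.
by rewrite mem_cat (map_f Negz) ?orbT // mem_iota; lia.
Qed.

Lemma tsumD I (F G : I -> {fps R}) : summable F -> summable G ->
  tsum (fun x => F x + G x) = tsum F + tsum G.
Proof.
move=> sF sG; apply: has_sum_tsum; apply: has_sumP => k.
have [s Hs] := sF k; have [t Ht] := sG k; pose u := undup (s ++ t).
have Hu x : x \notin u -> (fcoef (F x) k = 0) * (fcoef (G x) k = 0).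
  by rewrite mem_undup mem_cat negb_or => /andP[/Hs-> /Ht->].
have uu : uniq u by exact: undup_uniq.
exists u; split=> //.
  by move=> x /Hu[]; rewrite fcoefD => -> ->; rewrite addr0.
rewrite fcoefD (tsum_coef sF uu) ?(tsum_coef sG uu) ?big_split //.
all: by move=> x /Hu[].
Qed.

(** Makes the finite exceptional list uniform in all degrees below [k], as products require: a
    coefficient of a product involves all lower coefficients of its factors. *)
Lemma summable_le I (F : I -> {fps R}) k : summable F ->
  exists s : seq I, forall x, x \notin s -> fps_ord_ge k (F x).
Proof.
move=> sF; elim: k => [|k [s Hs]]; first by exists [::].
have [t Ht] := sF k; exists (s ++ t) => x.
rewrite mem_cat negb_or => /andP[/Hs xs /Ht xt] j.
by rewrite ltnS leq_eqVlt => /orP[/eqP ->|/xs].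
Qed.

Lemma summableZ I c (F : I -> {fps R}) :
  summable F -> summable (fun x => c * F x).
Proof.
move=> sF k; have [s Hs] := summable_le k.+1 sF; exists s => x /Hs Fx.
apply: ord_geMl Fx _ (ltnSn k).
Qed.

Lemma tsumZ I c (F : I -> {fps R}) :
  summable F -> tsum (fun x => c * F x) = c * tsum F.
Proof.
move=> sF; apply: has_sum_tsum; apply: has_sumP => k.
have [s Hs] := summable_le k.+1 sF; pose u := undup s.
have Hu x : x \notin u -> fps_ord_ge k.+1 (F x) by rewrite mem_undup => /Hs.
exists u; split; first exact: undup_uniq.
  by move=> x /Hu Fx; apply: ord_geMl Fx _ (ltnSn k).
transitivity (fcoef (c * \sum_(x <- u) F x) k); last by rewrite mulr_sumr fcoef_sum.
rewrite !fcoefM; apply: eq_bigr => i _; congr (_ * _).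
rewrite fcoef_sum; apply: tsum_coef => //; first exact: undup_uniq.
by move=> x /Hu; apply; lia.
Qed.

Lemma tsumN I (F : I -> {fps R}) :
  summable F -> tsum (fun x => - F x) = - tsum F.
Proof.
by move=> sF; rewrite -mulN1r -tsumZ //; apply: eq_tsum => x; rewrite mulN1r.
Qed.

Lemma summableN I (F : I -> {fps R}) :
  summable F -> summable (fun x => - F x).
Proof.
by move=> /(summableZ (-1)); apply: eq_summable => x; rewrite mulN1r.
Qed.

Lemma tsum_finite I s (F : I -> {fps R}) : uniq s ->
  (forall x, x \notin s -> F x = 0) -> tsum F = \sum_(x <- s) F x.
Proof.
move=> us F0; apply: has_sum_tsum; apply: has_sumP => k; exists s; split=> //.
  by move=> x /F0 ->.
by rewrite fcoef_sum.
Qed.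

Lemma tsum_fin (T : finType) (F : T -> {fps R}) : tsum F = \sum_x F x.
Proof.
rewrite (@tsum_finite _ (index_enum T)) ?index_enum_uniq // => x.
by rewrite mem_index_enum.
Qed.

(** The partial inverse [g] of [h] is chosen classically by [xget], with [None] off the image. *)
Lemma preimage_seq I J (h : J -> I) (s : seq I) : injective h ->
  exists t : seq J, uniq t /\ forall y, h y \in s -> y \in t.
Proof.
move=> hI; pose g x := xget None
  [set o | if o is Some y then h y = x else False]%classic.
have gh y : g (h y) = Some y.
  rewrite /g; case: xgetP => [[z|//] _ /= /hI -> //|/(_ (Some y))]; by case.
exists (undup (pmap g s)); split=> [|y ys]; first exact: undup_uniq.
by rewrite mem_undup mem_pmap -gh; apply: map_f.
Qed.

Section Reindex.
Variables (I J : choiceType) (h : J -> I) (F : I -> {fps R}).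
Hypotheses (hI : injective h) (F0 : forall x, F x != 0 -> exists y, x = h y).

Let sub_fibre k (s : seq J) x :
  (forall y, y \notin s -> fcoef (F (h y)) k = 0) ->
  x \notin map h s -> fcoef (F x) k = 0.
Proof.
move=> Hs xs; have [->//|/F0[y xy]] := eqVneq (F x) 0.
rewrite xy Hs //; apply: contra xs => ys; rewrite xy; exact: map_f.
Qed.

Lemma has_sum_inj f :
  fps_has_sum (fun y => F (h y)) f <-> fps_has_sum F f.
Proof.
split=> H; apply: has_sumP => k.
  have [s Hs] := has_sum_summable H k; pose u := undup s.
  have Hu y : y \notin u -> fcoef (F (h y)) k = 0 by rewrite mem_undup => /Hs.
  exists (map h u); split; first by rewrite map_inj_uniq ?undup_uniq.
    by move=> x; apply: sub_fibre Hu.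
  by rewrite big_map (has_sum_coef H (undup_uniq s)).
have [s Hs] := has_sum_summable H k.
have [u [uu su]] := preimage_seq s hI.
have Hu y : y \notin u -> fcoef (F (h y)) k = 0.
  by move=> yu; apply: Hs; apply: contra yu; apply: su.
exists u; split=> //.
rewrite -(big_map h xpredT (fun x => fcoef (F x) k)); apply: has_sum_coef => //.
  by rewrite map_inj_uniq.
by move=> x; apply: sub_fibre Hu.
Qed.

(** Both families have the same set of unconditional sums, so the values picked by [xget], the
    default included, coincide. *)
Lemma tsum_inj : tsum (fun y => F (h y)) = tsum F.
Proof.
by rewrite /tsum; congr xget; apply/seteqP; split=> f /has_sum_inj.
Qed.

End Reindex.

Lemma summable_comp I J (h : J -> I) (F : I -> {fps R}) :
  injective h -> summable F -> summable (fun y => F (h y)).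
Proof.
move=> hI sF k; have [s Hs] := sF k; have [t [_ st]] := preimage_seq s hI.
by exists t => y yt; apply: Hs; apply: contra yt; apply: st.
Qed.

Lemma tsum_bij I J (h : J -> I) (F : I -> {fps R}) :
  bijective h -> tsum (fun y => F (h y)) = tsum F.
Proof.
move=> [g hK gK]; apply: tsum_inj; first exact: can_inj hK.
by move=> x _; exists (g x); rewrite gK.
Qed.

Section Fubini.
Variables (I J : choiceType) (F : I * J -> {fps R}).
Hypothesis sF : summable F.

Lemma summable_row i : summable (fun j => F (i, j)).
Proof. by apply: summable_comp sF => j j' []. Qed.

Let box k : exists s t, [/\ uniq s, uniq t
  & forall x, ~~ ((x.1 \in s) && (x.2 \in t)) -> fcoef (F x) k = 0].
Proof.
have [s Hs] := sF k; exists (undup (map fst s)), (undup (map snd s)).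
split; try exact: undup_uniq.
move=> x; rewrite !mem_undup => xs; apply: Hs; apply: contra xs => xs.
by rewrite (map_f fst xs) (map_f snd xs).
Qed.

Lemma summable_fubini : summable (fun i => tsum (fun j => F (i, j))).
Proof.
move=> k; have [s [t [us ut H]]] := box k; exists s => i ins.
rewrite (tsum_coef (@summable_row i) ut) ?big1 // => [j _|j jt]; apply: H => /=.
  by rewrite (negPf ins).
by rewrite (negPf ins).
Qed.

Lemma tsum_fubini : tsum F = tsum (fun i => tsum (fun j => F (i, j))).
Proof.
apply: has_sum_tsum; apply: has_sumP => k.
have [s [t [us ut H]]] := box k.
exists [seq (i, j) | i <- s, j <- t]; split.
- by apply: allpairs_uniq => // -[? ?] [? ?].
- move=> -[i j] ij; apply: H => /=; apply: contra ij => /andP[si tj].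
  exact: (allpairs_f pair).
rewrite (tsum_coef summable_fubini us) => [|i ins].
  rewrite big_allpairs; apply: eq_bigr => i _.
  rewrite (tsum_coef (@summable_row i) ut) // => j jt; apply: H => /=.
  by rewrite (negPf jt) andbF.
rewrite (tsum_coef (@summable_row i) ut) ?big1 // => [j _|j jt]; apply: H => /=.
  by rewrite (negPf ins).
by rewrite (negPf ins).
Qed.

End Fubini.

(** Cuts the index set into finitely many classes; it serves for signs of integers, residues modulo
    3 and parity. *)
Lemma tsum_split I J (B : finType) (h : J * B -> I) (F : I -> {fps R}) :
  bijective h -> summable F ->
  tsum F = tsum (fun j => \sum_b F (h (j, b))).
Proof.
move=> hB sF; rewrite -(tsum_bij F hB) tsum_fubini; last first.
  by apply: summable_comp sF; apply: bij_inj.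
by apply: eq_tsum => j; rewrite tsum_fin.
Qed.

Lemma summableM I J (F : I -> {fps R}) (G : J -> {fps R}) :
  summable F -> summable G -> summable (fun x : I * J => F x.1 * G x.2).
Proof.
move=> sF sG k; have [s Hs] := summable_le k.+1 sF.
have [t Ht] := summable_le k.+1 sG.
exists [seq (i, j) | i <- s, j <- t] => -[i j] /=.
have [si|/Hs Fi _] := boolP (i \in s); last apply: ord_geMr Fi _ (ltnSn k).
have [tj|/Ht Gj _] := boolP (j \in t); last apply: ord_geMl Gj _ (ltnSn k).
by move=> /negP[]; apply: (allpairs_f pair).
Qed.

Lemma tsumM I J (F : I -> {fps R}) (G : J -> {fps R}) :
  summable F -> summable G ->
  tsum F * tsum G = tsum (fun x : I * J => F x.1 * G x.2).
Proof.
move=> sF sG; rewrite (tsum_fubini (summableM sF sG)) mulrC -tsumZ //=.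
by apply: eq_tsum => i; rewrite mulrC tsumZ.
Qed.

Lemma tsum_nat_recl (F : nat -> {fps R}) : summable F ->
  tsum F = F 0%N + tsum (fun n => F n.+1).
Proof.
move=> sF; pose F0 n := if n == 0%N then F 0%N else 0.
pose F1 n := if n == 0%N then 0 else F n.
have s0 : summable F0.
  by move=> k; exists [:: 0%N] => x; rewrite inE /F0 => /negPf ->.
have s1 : summable F1.
  by move=> k; have [s Hs] := sF k; exists s => x /Hs; rewrite /F1; case: eqP.
rewrite (_ : tsum F = tsum (fun n => F0 n + F1 n)); last first.
  by apply: eq_tsum => n; rewrite /F0 /F1; case: eqP => [->|]; rewrite ?addr0 ?add0r.
rewrite tsumD //; congr (_ + _).
  by rewrite (@tsum_finite _ [:: 0%N]) ?big_seq1 // => x; rewrite inE /F0 => /negPf ->.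
symmetry; apply: (@tsum_inj _ _ S F1); first exact: succn_inj.
by case=> [|n _]; [rewrite /F1 /= eqxx|exists n].
Qed.

Lemma tsum_telescope (F : nat -> {fps R}) : summable F ->
  tsum (fun n => F n - F n.+1) = F 0%N.
Proof.
move=> sF; have sF1 : summable (fun n => F n.+1).
  exact: summable_comp succn_inj sF.
by rewrite tsumD ?tsumN ?(tsum_nat_recl sF) ?addrK //; apply: summableN.
Qed.

Lemma ord_ge_tsum I n (F : I -> {fps R}) : summable F ->
  (forall x, fps_ord_ge n (F x)) -> fps_ord_ge n (tsum F).
Proof.
move=> sF Fn k kn; rewrite (@tsum_coef _ _ _ [::]) ?big_nil // => x _.
exact: Fn.
Qed.

Lemma ord_ge_tsum_fin I n (F : I -> {fps R}) s : summable F -> uniq s ->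
  (forall x, x \notin s -> fps_ord_ge n (F x)) ->
  fps_ord_ge n (tsum F - \sum_(x <- s) F x).
Proof.
move=> sF us Fn k kn; rewrite fcoefD fcoefN fcoef_sum.
by rewrite (tsum_coef sF us) ?subrr // => x /Fn; apply.
Qed.

Lemma tsum_int (F : int -> {fps R}) : summable F ->
  tsum F = tsum (fun n : nat => F n%:Z + F (Negz n)).
Proof.
pose h (x : nat * bool) := if x.2 then Posz x.1 else Negz x.1.
move=> sF; rewrite (@tsum_split _ _ _ h) //.
  by apply: eq_tsum => n; rewrite big_bool.
by exists (fun z => match z with Posz n => (n, true) | Negz n => (n, false) end)
  => [[n []]|[]].
Qed.

Lemma tsum_mod3 (F : nat -> {fps R}) : summable F ->
  tsum F = tsum (fun n => F (3 * n)%N + F (3 * n + 1)%N + F (3 * n + 2)%N).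
Proof.
pose h (x : nat * 'I_3) := (3 * x.1 + x.2)%N.
move=> sF; rewrite (@tsum_split _ _ _ h) //.
  apply: eq_tsum => n; rewrite !big_ord_recr big_ord0 /h /= add0r.
  by rewrite addn0.
exists (fun n => (n %/ 3, inord (n %% 3))%N) => [[n i]|n]; rewrite /h /=.
  have i3 := ltn_ord i; congr pair; first by lia.
  by apply: val_inj; rewrite /= inordK; lia.
by rewrite inordK; lia.
Qed.

End Summation.

(** * Gaussian binomials and Schur's polynomials *)

Section GaussianBinomial.
Variable R : comNzRingType.
Implicit Types (p z : R) (f : nat -> R).

Definition poch z p n : R := \prod_(c < n) (1 - z * p ^+ c).

Lemma poch0 z p : poch z p 0 = 1. Proof. by rewrite /poch big_ord0. Qed.

Lemma pochS z p n : poch z p n.+1 = poch z p n * (1 - z * p ^+ n).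
Proof. by rewrite /poch big_ord_recr. Qed.

Lemma pochD z p n m : poch z p (n + m) = poch z p n * poch (z * p ^+ n) p m.
Proof.
elim: m => [|m IHm]; first by rewrite addn0 poch0 mulr1.
by rewrite addnS !pochS IHm -mulrA -(mulrA z) -exprD.
Qed.

(** Defined by Pascal's rule, the Gaussian binomial is a polynomial in [p] and makes sense without
    division. *)
Fixpoint qbin p n k : R :=
  match n, k with
  | _, 0 => 1
  | 0, _.+1 => 0
  | n.+1, k.+1 => qbin p n k + p ^+ k.+1 * qbin p n k.+1
  end.

Lemma qbin0 p n : qbin p n 0 = 1. Proof. by case: n. Qed.

Lemma qbinS p n k :
  qbin p n.+1 k.+1 = qbin p n k + p ^+ k.+1 * qbin p n k.+1.
Proof. by []. Qed.

Lemma qbin_small p n k : (n < k)%N -> qbin p n k = 0.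
Proof.
elim: n k => [|n IHn] [|k] //= nk.
by rewrite !IHn ?mulr0 ?addr0 //; lia.
Qed.

Lemma qbinn p n : qbin p n n = 1.
Proof.
elim: n => //= n IHn; rewrite IHn qbin_small ?mulr0 ?addr0 //; lia.
Qed.

(** The mirror form of Pascal's rule. The difference [n - k] is truncated only when [n < k], where
    [qbin p n k] vanishes. *)
Lemma qbinSr p n k :
  qbin p n.+1 k.+1 = qbin p n k.+1 + p ^+ (n - k) * qbin p n k.
Proof.
elim: n k => [|n IHn] k.
  by case: k => [|k]; rewrite qbinS /= ?expr0; ring.
have [nk|kn|->] := ltngtP n.+1 k.
- by rewrite !qbin_small; [ring|lia..].
- case: k kn => [|k] kn.
    by rewrite [LHS]qbinS [in LHS]IHn qbinS !qbin0 !subn0 !exprS; ring.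
  rewrite [LHS]qbinS {1}IHn [in LHS]IHn [qbin p n.+1 k.+2]qbinS.
  rewrite [qbin p n.+1 k.+1 in RHS]qbinS.
  rewrite subSS (_ : n - k = (n - k.+1).+1)%N; last by lia.
  by rewrite !exprS; ring.
by rewrite qbinn subnn qbinn qbin_small // expr0; ring.
Qed.

(** Induction on the total, splitting the new factor as 1 - p^(a+b+2) = (1 - p^(a+1)) + p^(a+1) (1 -
    p^(b+1)), one part for each summand of Pascal's rule. *)
Lemma qbin_poch p a b :
  qbin p (a + b) a * (poch p p a * poch p p b) = poch p p (a + b).
Proof.
have [m] := ubnP (a + b)%N; elim: m a b => // m IHm [|a] [|b] ltm.
- by rewrite !poch0 qbin0 !mulr1.
- by rewrite add0n qbin0 poch0 !mul1r.
- by rewrite addn0 qbinn poch0 mul1r mulr1.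
have E1 := IHm a b.+1 ltac:(lia).
have := IHm a.+1 b ltac:(lia); rewrite addSnnS => E2.
rewrite addSn qbinS (pochS p p (a + b.+1)) mulrDl.
transitivity ((1 - p ^+ a.+1) *
    (qbin p (a + b.+1) a * (poch p p a * poch p p b.+1))
  + p ^+ a.+1 * (1 - p ^+ b.+1) *
    (qbin p (a + b.+1) a.+1 * (poch p p a.+1 * poch p p b))).
  by rewrite !pochS -!exprS; ring.
by rewrite E1 E2 -exprS -addSn exprD; ring.
Qed.

Lemma binS2 r : ('C(r.+1, 2) = 'C(r, 2) + r)%N.
Proof. by rewrite binS bin1 addnC. Qed.

Lemma bin2_double r : ('C(r, 2) * 2 + r = r * r)%N.
Proof. by elim: r => // r; rewrite binS2; lia. Qed.

(** Pascal's rule moved onto the coefficients: an induction on [n] then only has to compare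
    [f r * p ^+ r + f r.+1] with the previous coefficient. *)
Lemma sum_qbinS f p n :
  \sum_(r < n.+2) f r * qbin p n.+1 r =
  \sum_(r < n.+1) (f r * p ^+ r + f r.+1) * qbin p n r.
Proof.
rewrite big_ord_recl /=.
under eq_bigr => r _ do rewrite /bump add1n mulrDr.
rewrite big_split /= addrCA addrC.
under [RHS]eq_bigr => r _ do rewrite mulrDl.
rewrite big_split /=; congr (_ + _).
rewrite big_ord_recr /= qbin_small // !mulr0 addr0.
rewrite [RHS]big_ord_recl /= qbin0 expr0 !mulr1; congr (_ + _).
by apply: eq_bigr => r _; rewrite /bump add1n mulrA.
Qed.

Lemma sum_qbinSr f p n :
  \sum_(r < n.+2) f r * qbin p n.+1 r =
  \sum_(r < n.+1) (f r + p ^+ (n - r) * f r.+1) * qbin p n r.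
Proof.
rewrite big_ord_recl.
under eq_bigr => r _ do rewrite lift0 qbinSr mulrDr.
rewrite big_split /= addrA.
under [RHS]eq_bigr => r _ do rewrite mulrDl.
rewrite big_split /=; congr (_ + _); last first.
  by apply: eq_bigr => r _; rewrite mulrA [p ^+ _ * _]mulrC.
rewrite big_ord_recr /= qbin_small // mulr0 addr0.
by rewrite [RHS]big_ord_recl /= qbin0.
Qed.

(** After a Pascal step the two contributions to the coefficient differ by (1 - z p^(s-r)) - 1 = -z
    p^(s-r); together with p^r this is the factor -z p^s, the same for every r. *)
Lemma sum_qbin_poch p z s :
  \sum_(r < s.+1) (-1) ^+ r * p ^+ 'C(r, 2) * poch z p (s - r) * qbin p s r
  = (- z) ^+ s * p ^+ 'C(s, 2).
Proof.
elim: s => [|s IHs]; first by rewrite big_ord1 /= poch0 !expr0 !mulr1.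
rewrite (sum_qbinS (fun r => (-1) ^+ r * p ^+ 'C(r, 2) * poch z p (s.+1 - r))).
transitivity ((- z * p ^+ s) * ((- z) ^+ s * p ^+ 'C(s, 2))); last first.
  by rewrite binS2 exprD exprS; ring.
rewrite -IHs mulr_sumr; apply: eq_bigr => r _.
have rs : (r <= s)%N by rewrite -ltnS.
have -> : p ^+ s = p ^+ r * p ^+ (s - r) by rewrite -exprD subnKC.
rewrite subSn // subSS pochS binS2 exprD exprS.
by ring.
Qed.

Definition diag_sum p f t : R := \sum_(r < t.+1) f r * qbin p (t - r) r.

(** Only indices with [r.*2 <= t] carry a nonzero binomial; this licenses truncated subtractions in
    the exponents below. *)
Lemma eq_diag_sum p f g t :
  (forall r, (r.*2 <= t)%N -> f r = g r) -> diag_sum p f t = diag_sum p g t.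
Proof.
move=> fg; apply: eq_bigr => r _; have [rt|tr] := leqP r.*2 t.
  by rewrite fg.
by rewrite qbin_small ?mulr0 //; lia.
Qed.

Lemma diag_sumZ p c f t :
  diag_sum p (fun r => c * f r) t = c * diag_sum p f t.
Proof. by rewrite /diag_sum mulr_sumr; under eq_bigr do rewrite -mulrA. Qed.

Let diag_widen f p t : diag_sum p f t.+2 = \sum_(r < t.+2) f r * qbin p (t.+2 - r) r.
Proof.
by rewrite /diag_sum big_ord_recr /= subnn mulr0 addr0.
Qed.

Lemma diag_sumS p f t : diag_sum p f t.+2 =
  diag_sum p (fun r => f r * p ^+ r) t.+1 + diag_sum p (fun r => f r.+1) t.
Proof.
rewrite diag_widen /diag_sum big_ord_recl [X in _ = X + _]big_ord_recl /= -addrA.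
rewrite expr0 !mulr1; congr (_ + _); rewrite -big_split; apply: eq_bigr => r _ /=.
have rt : (r <= t)%N by rewrite -ltnS.
by rewrite /bump add1n !subSS subSn //=; ring.
Qed.

(* Where the difference t - r.*2 is truncated, the binomial vanishes. *)
Lemma diag_sumSr p f t : diag_sum p f t.+2 =
  diag_sum p f t.+1 + diag_sum p (fun r => p ^+ (t - r.*2) * f r.+1) t.
Proof.
rewrite diag_widen /diag_sum big_ord_recl [X in _ = X + _]big_ord_recl /= -addrA.
congr (_ + _); rewrite -big_split; apply: eq_bigr => r _ /=.
have rt : (r <= t)%N by rewrite -ltnS.
rewrite /bump add1n !subSS subSn // qbinSr (_ : t - r.*2 = t - r - r)%N; last by lia.
by ring.
Qed.

End GaussianBinomial.

Section Schur.
Variables (R : comNzRingType) (p : R).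

Definition schur1 := diag_sum p (fun r => (-1) ^+ r * p ^+ 'C(r, 2)).

Let schur1' := diag_sum p (fun r => (-1) ^+ r * p ^+ 'C(r.+1, 2)).

(** One Pascal rule writes [schur1] as a difference of two values of [schur1']; the other writes
    such a difference as a multiple of [schur1]. The resulting one-term recurrence of step 3 is the
    source of the residues modulo 3. *)
Lemma schur1_rec t : schur1 t.+3 = - p ^+ t.+1 * schur1 t.
Proof.
have E1 u : schur1 u.+2 = schur1' u.+1 - schur1' u.
  rewrite /schur1 diag_sumS -[in RHS]mulN1r /schur1' -diag_sumZ.
  congr (_ + _); apply: eq_diag_sum => r _.
    by rewrite binS2 exprD mulrA.
  by rewrite exprS -mulrA.
have E2 u : schur1' u.+2 = schur1' u.+1 - p ^+ u.+1 * schur1 u.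
  rewrite {1}/schur1' diag_sumSr -mulNr -diag_sumZ; congr (_ + _).
  apply: eq_diag_sum => r ru.
  have -> : 'C(r.+2, 2) = ('C(r, 2) + r.*2 + 1)%N by rewrite !binS2; lia.
  have -> : p ^+ u.+1 = p ^+ (u - r.*2) * p ^+ (r.*2 + 1).
    by rewrite -exprD; congr (_ ^+ _); lia.
  by rewrite !exprD !exprS; ring.
by rewrite E1 E2; ring.
Qed.

(** The initial values are 1, 1, 0. The exponents are the generalized pentagonal numbers u(3u-1)/2
    and u(3u+1)/2. *)
Lemma schur1E u : [/\ schur1 (3 * u) = (-1) ^+ u * p ^+ ('C(u, 2) * 3 + u),
  schur1 (3 * u + 1) = (-1) ^+ u * p ^+ ('C(u, 2) * 3 + u * 2) &
  schur1 (3 * u + 2) = 0].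
Proof.
elim: u => [|u [IH0 IH1 IH2]].
  rewrite /schur1 /diag_sum !big_ord_recl !big_ord0 /= /bump /=.
  by split; rewrite ?addn0 ?addn1 ?subSS ?subn0
    ?(@bin_small 0 2, @bin_small 1 2) ?binn ?mul0n ?expr0 //=; ring.
rewrite (_ : 3 * u.+1 + 2 = (3 * u + 2).+3)%N; last by lia.
rewrite (_ : 3 * u.+1 + 1 = (3 * u + 1).+3)%N; last by lia.
rewrite (_ : 3 * u.+1 = (3 * u).+3)%N; last by lia.
rewrite !schur1_rec IH0 IH1 IH2 mulr0 binS2; split=> //.
  rewrite (_ : (_ + _) * 3 + _ = (3 * u).+1 + ('C(u, 2) * 3 + u))%N; last by lia.
  by rewrite [in RHS]exprD (exprS (-1)); ring.
rewrite (_ : (_ + _) * 3 + _ = (3 * u + 1).+1 + ('C(u, 2) * 3 + u * 2))%N; last by lia.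
by rewrite [in RHS]exprD (exprS (-1)); ring.
Qed.

(* The companion sum schur0' (like schur1' above) closes a two-term system of
   recurrences, from which it is then eliminated. *)
Definition schur0 t :=
  diag_sum p (fun r => (-1) ^+ r * p ^+ ('C(t - r, 2) + r * r)) t.

Let schur0' t :=
  diag_sum p (fun r => (-1) ^+ r * p ^+ ('C(t - r, 2) + 'C(r, 2) * 2)) t.

(** Formally [schur0 t] is p^C(t,2) times [schur1 t] with p replaced by 1/p, which explains the same
    signs and the same vanishing. Since [p] need not be invertible, the recurrence is derived
    directly. *)
Lemma schur0_rec t : schur0 t.+3 = - p ^+ (t * 2 + 2) * schur0 t.
Proof.
have E1 u : schur0 u.+2 =
    p ^+ u.+1 * schur0' u.+1 - p ^+ (u * 2 + 1) * schur0' u.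
  rewrite /schur0 diag_sumSr -mulNr /schur0' -!diag_sumZ.
  congr (_ + _); apply: eq_diag_sum => r ru.
    rewrite (_ : _ + r * r = u.+1 + ('C(u.+1 - r, 2) + 'C(r, 2) * 2))%N.
      by rewrite exprD; ring.
    have -> : (u.+2 - r = (u.+1 - r).+1)%N by lia.
    by have := bin2_double r; rewrite binS2; lia.
  have -> : p ^+ (u * 2 + 1) = p ^+ (u - r.*2) * p ^+ (u + r.*2 + 1).
    by rewrite -exprD; congr (_ ^+ _); lia.
  rewrite (_ : _ + r.+1 * r.+1 =
    u + r.*2 + 1 + ('C(u - r, 2) + 'C(r, 2) * 2))%N.
    by rewrite exprD exprS; ring.
  have -> : (u.+2 - r.+1 = (u - r).+1)%N by lia.
  by have := bin2_double r; rewrite binS2; lia.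
have E2 u : schur0' u.+2 = p ^+ u.+1 * schur0' u.+1 - p ^+ u * schur0 u.
  rewrite /schur0 {1}/schur0' diag_sumS -mulNr /schur0' -!diag_sumZ.
  congr (_ + _); apply: eq_diag_sum => r ru.
    rewrite -mulrA -exprD.
    rewrite (_ : _ + _ + r = u.+1 + ('C(u.+1 - r, 2) + 'C(r, 2) * 2))%N.
      by rewrite exprD; ring.
    have -> : (u.+2 - r = (u.+1 - r).+1)%N by lia.
    by rewrite binS2; lia.
  rewrite (_ : _ + 'C(r.+1, 2) * 2 = u + ('C(u - r, 2) + r * r))%N.
    by rewrite exprD exprS; ring.
  have -> : (u.+2 - r.+1 = (u - r).+1)%N by lia.
  by have := bin2_double r; rewrite !binS2; lia.
rewrite E1 E2.
have -> : p ^+ (t * 2 + 2) = p ^+ t.+2 * p ^+ t.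
  by rewrite -exprD; congr (_ ^+ _); lia.
have -> : p ^+ (t.+1 * 2 + 1) = p ^+ t.+2 * p ^+ t.+1.
  by rewrite -exprD; congr (_ ^+ _); lia.
by ring.
Qed.

Lemma schur0E u : [/\ schur0 (3 * u) = (-1) ^+ u * p ^+ ('C(u, 2) * 6 + u * 2),
  schur0 (3 * u + 1) = (-1) ^+ u * p ^+ ('C(u, 2) * 6 + u * 4) &
  schur0 (3 * u + 2) = 0].
Proof.
elim: u => [|u [IH0 IH1 IH2]].
  rewrite /schur0 /diag_sum !big_ord_recl !big_ord0 /= /bump /=.
  by split; rewrite ?addn0 ?addn1 ?subSS ?subn0
    ?(@bin_small 0 2, @bin_small 1 2) ?binn ?mul0n ?expr0 //=; ring.
rewrite (_ : 3 * u.+1 + 2 = (3 * u + 2).+3)%N; last by lia.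
rewrite (_ : 3 * u.+1 + 1 = (3 * u + 1).+3)%N; last by lia.
rewrite (_ : 3 * u.+1 = (3 * u).+3)%N; last by lia.
rewrite !schur0_rec IH0 IH1 IH2 mulr0 binS2; split=> //.
  rewrite (_ : (_ + _) * 6 + _ = (3 * u * 2 + 2) + ('C(u, 2) * 6 + u * 2))%N; last by lia.
  by rewrite [in RHS]exprD (exprS (-1)); ring.
rewrite (_ : (_ + _) * 6 + _ =
  (3 * u + 1) * 2 + 2 + ('C(u, 2) * 6 + u * 4))%N; last by lia.
by rewrite [in RHS]exprD (exprS (-1)); ring.
Qed.

End Schur.

(** * The sum over j_1, ..., j_m as a single alternating sum *)

Section Limits.
Variable R : comUnitRingType.
Implicit Types (a p f g : {fps R}).

Lemma ord_ge_trans n f g h :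
  fps_ord_ge n (f - g) -> fps_ord_ge n (g - h) -> fps_ord_ge n (f - h).
Proof. by move=> fg gh; rewrite -(subrK g f) -addrA; apply: ord_geD. Qed.

Lemma ord_ge_sym n f g : fps_ord_ge n (f - g) -> fps_ord_ge n (g - f).
Proof. by move=> fg; rewrite -opprB; apply: ord_geN. Qed.

Lemma ord_ge_congM n f g f' g' : fps_ord_ge n (f - g) ->
  fps_ord_ge n (f' - g') -> fps_ord_ge n (f * f' - g * g').
Proof.
move=> fg fg'; apply: (@ord_ge_trans _ _ (g * f')).
  by rewrite -mulrBl; apply: ord_geMr.
by rewrite -mulrBr; apply: ord_geMl.
Qed.

Lemma ord_ge_mulI n f g h : h \is a GRing.unit ->
  fps_ord_ge n (h * f - h * g) -> fps_ord_ge n (f - g).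
Proof.
by move=> uh H; rewrite -(mulKr uh (f - g)); apply: ord_geMl; rewrite mulrBr.
Qed.

(** The factors 1 - a p^c with c >= n are congruent to 1 modulo order [n]. *)
Lemma ord_ge_poch a p n N : fcoef p 0 = 0 -> (n <= N)%N ->
  fps_ord_ge n (poch a p N - qpoch_oo [:: a] p).
Proof.
move=> p0 nN.
have step M : (n <= M)%N -> fps_ord_ge n (poch a p M - poch a p n).
  elim: M => [|M IHM].
    by rewrite leqn0 => /eqP ->; apply: ord_ge0n.
  rewrite leq_eqVlt => /orP[/eqP <-|]; first by rewrite subrr; apply: ord_ge0.
  rewrite ltnS => nM; apply: ord_ge_trans (IHM nM).
  rewrite pochS mulrBr mulr1 addrAC subrr add0r; apply: ord_geN.
  by apply: ord_geMl; apply: ord_geMl; apply: ord_geW nM _; apply: ord_geX.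
move=> k kn; have [M HM] := qpoch1_cvg a p0 k.
rewrite fcoefD fcoefN /qpoch_oo big_seq1 -(HM (maxn M n)) ?leq_maxl //.
rewrite big_add1 big_mkord -fcoefN -fcoefD.
have := ord_ge_trans (step N nN) (ord_ge_sym (step _ (leq_maxr M n))).
by apply.
Qed.

Lemma poch_unit a p n : fcoef a 0 = 0 -> poch a p n \is a GRing.unit.
Proof.
move=> a0; apply: rpred_prod => c _.
by rewrite fps_unitE fcoefD fcoefN fcoef0M a0 mul0r subr0 fcoef1 unitr1.
Qed.

Lemma qpochE a p n : qpoch [:: a] p n = poch a p n.
Proof. by rewrite /qpoch big_seq1 big_add1 big_mkord. Qed.

Lemma qpoch_oo2 a b p :
  qpoch_oo [:: a; b] p = qpoch_oo [:: a] p * qpoch_oo [:: b] p.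
Proof. by rewrite /qpoch_oo !big_cons !big_nil !mulr1. Qed.

End Limits.

Section MultiSum.
Variables (R : comUnitRingType) (p : {fps R}).
Hypothesis p0 : fcoef p 0 = 0.

Let qf := poch p p.
Let qfU n : qf n \is a GRing.unit. Proof. exact: poch_unit. Qed.

Definition qratio i r : {fps R} := qf (i + r) / qf r.

Lemma qratioS i r :
  (1 - p ^+ r.+1) * qratio i r.+1 = (1 - p ^+ (i + r).+1) * qratio i r.
Proof.
apply: (mulIr (qfU r.+1)); rewrite /qratio -!mulrA mulVr // mulr1 addnS.
rewrite /qf !pochS -!exprS mulKr //; ring.
Qed.

(** [qratio i r] is the polynomial (p^(r+1); p)_i, which makes sense for negative r too. The
    reflection r -> -r-i-1 multiplies the remaining product by -p^((k+1-b)(i+2r+1)), so the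
    parenthesis folds a bilateral series in half. *)
Definition alt_term k b i r : {fps R} :=
  (-1) ^+ r * p ^+ (k * (r * r + i * r) + 'C(r, 2) + b * r)
  * (1 - p ^+ ((k.+1 - b) * (i + r * 2 + 1))) * qratio i r.

Definition alt_sum k b i := tsum (alt_term k b i).

Lemma ord_alt_term k b i r : (0 < k)%N -> fps_ord_ge r (alt_term k b i r).
Proof.
move=> k0; do 2!apply: ord_geMr; apply: ord_geMl.
by apply: ord_geW _ (ord_geX p0); nia.
Qed.

Lemma summable_alt_term k b i : (0 < k)%N -> summable (alt_term k b i).
Proof. by move=> k0; apply: summable_nat => r; apply: ord_alt_term. Qed.

(** Here [H] is a certificate of the kind found by creative telescoping. *)
Lemma sum_telescope (F G H : nat -> {fps R}) : summable F -> summable G ->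
  summable H -> H 0%N = 0 -> (forall r, F r - G r = H r - H r.+1) ->
  tsum F = tsum G.
Proof.
move=> sF sG sH H0 FG; apply/eqP; rewrite -subr_eq0 -tsumN // -tsumD //.
  by rewrite (eq_tsum FG) tsum_telescope // H0.
exact: summableN.
Qed.

(** The counterpart of the fact that the linear form in the J_k is empty for both b = 0 and b = 1.
    The difference of the r-th terms splits into [H r] and a multiple of 1 - p^(i+r+1), which
    [qratioS] identifies with [- H r.+1]. *)
Lemma alt_sum_b0 k i : (0 < k)%N -> alt_sum k 0 i = alt_sum k 1 i.
Proof.
move=> k0.
pose H r : {fps R} := (-1) ^+ r * p ^+ (k * (r * r + i * r) + 'C(r, 2))
  * (1 - p ^+ r) * qratio i r.
apply: (@sum_telescope _ _ H); try exact: summable_alt_term.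
- apply: summable_nat => r; do 2!apply: ord_geMr; apply: ord_geMl.
  by apply: ord_geW _ (ord_geX p0); nia.
- by rewrite /H expr0 subrr mulr0 mul0r.
move=> r; rewrite /alt_term /H.
rewrite -[in RHS](mulrA _ (1 - p ^+ r.+1)) qratioS.
have -> : p ^+ (k.+1 * (i + r * 2 + 1)) =
  p ^+ (k * (i + r * 2 + 1) + r) * p ^+ (i + r).+1.
  by rewrite -exprD; congr (_ ^+ _); lia.
have -> : p ^+ (k * (r.+1 * r.+1 + i * r.+1) + 'C(r.+1, 2)) =
  p ^+ (k * (r * r + i * r) + 'C(r, 2)) * p ^+ (k * (i + r * 2 + 1) + r).
  by rewrite -exprD; congr (_ ^+ _); rewrite binS2; nia.
rewrite !mul0n !addn0 mul1n subSS subn0 !exprD !exprS.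
by ring.
Qed.

Lemma alt_sum11S i : alt_sum 1 1 i = alt_sum 1 1 i.+1.
Proof.
pose H r : {fps R} := (-1) ^+ r * p ^+ (r * r + i * r + 'C(r.+1, 2))
  * (1 - p ^+ r) * qratio i r.
apply: (@sum_telescope _ _ H); try exact: summable_alt_term.
- apply: summable_nat => r; do 2!apply: ord_geMr; apply: ord_geMl.
  by apply: ord_geW _ (ord_geX p0); nia.
- by rewrite /H expr0 subrr mulr0 mul0r.
move=> r; rewrite /alt_term /H.
rewrite -[in RHS](mulrA _ (1 - p ^+ r.+1)) qratioS.
have -> : qratio i.+1 r = (1 - p ^+ (i + r).+1) * qratio i r.
  by rewrite /qratio addSn /qf pochS -exprS; ring.
have -> : p ^+ (r.+1 * r.+1 + i * r.+1 + 'C(r.+2, 2)) =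
  p ^+ (r * r + i * r + 'C(r.+1, 2)) * p ^+ (i + r * 3 + 2).
  by rewrite -exprD; congr (_ ^+ _); rewrite !binS2; nia.
have E j : (1 * (r * r + j * r) + 'C(r, 2) + 1 * r =
    r * r + j * r + 'C(r.+1, 2))%N by rewrite binS2; lia.
rewrite !E !mul1n.
rewrite (_ : p ^+ (r * r + i.+1 * r + 'C(r.+1, 2)) =
  p ^+ (r * r + i * r + 'C(r.+1, 2)) * p ^+ r); last first.
  by rewrite -exprD; congr (_ ^+ _); lia.
rewrite (_ : i + r * 3 + 2 = (i + r).+1 + r * 2 + 1)%N; last by lia.
rewrite (_ : i.+1 + r * 2 + 1 = (i + r).+1 + r + 1)%N; last by lia.
rewrite (_ : i + r * 2 + 1 = (i + r).+1 + r)%N; last by lia.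
rewrite (exprS (-1)) [p ^+ (_ + r * 2 + 1)]exprD [p ^+ (_ + r * 2)]exprD.
rewrite [p ^+ (_ + r + 1)]exprD [p ^+ ((i + r).+1 + r)]exprD muln2 -addnn.
by rewrite [p ^+ (r + r)]exprD !expr1; ring.
Qed.

(** Being independent of [i], the value may be computed modulo order [n] at [i = n]: there the term
    r = 0 is (1 - p^(n+1)) (p; p)_n and every later term has order at least [n]. *)
Lemma alt_sum11 i : alt_sum 1 1 i = qpoch_oo [:: p] p.
Proof.
have T0 n : alt_sum 1 1 n = alt_sum 1 1 0.
  by elim: n => // n IHn; rewrite -alt_sum11S.
rewrite T0; apply: ord_ge_eq => n; rewrite -(T0 n).
apply: ord_ge_trans (ord_ge_poch p p0 (leqnn n)).
rewrite /alt_sum (tsum_nat_recl (summable_alt_term _ _ _)) //.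
have -> : alt_term 1 1 n 0 = (1 - p ^+ (n + 1)) * qf n.
  rewrite /alt_term /qratio !addn0 muln0 expr0 mul1r.
  by rewrite [qf 0]poch0 divr1 mul1n ?addn0 muln0 expr0 !mul1r subSS subn0 mul1n.
rewrite addrAC.
apply: ord_geD.
  rewrite mulrBl mul1r addrAC subrr add0r; apply: ord_geN; apply: ord_geMr.
  by apply: ord_geW _ (ord_geX p0); lia.
apply: ord_ge_tsum.
  by apply: summable_comp succn_inj (summable_alt_term _ _ _).
move=> r; do 2!apply: ord_geMr; apply: ord_geMl.
by apply: ord_geW _ (ord_geX p0); nia.
Qed.

Lemma qbin_div r s : (r <= s)%N ->
  (qf r * qf (s - r))^-1 = qbin p s r / qf s.
Proof.
move=> rs; have U : qf r * qf (s - r) \is a GRing.unit by rewrite unitrM !qfU.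
apply: (mulIr U); rewrite mulVr // mulrAC.
by rewrite -{1}(subnKC rs) [_ * (_ * _)]qbin_poch subnKC // mulrV.
Qed.

(** Regroup by s = j + r. Since j^2 + i j + r^2 + (i + 2 j) r = s^2 + i s, all that still depends on
    r within a group is the sum evaluated by [sum_qbin_poch]. Its value contributes p^(s^2 + i s +
    s), which raises both [k] and [b] by one. *)
Lemma alt_sum_rec k b i : (0 < k)%N -> alt_sum k.+1 b.+1 i =
  tsum (fun j => p ^+ (k * (j * j + i * j) + b * j) / qf j
                 * alt_sum k b (i + j * 2)).
Proof.
move=> k0.
pose G x := p ^+ (k * (x.1 * x.1 + i * x.1) + b * x.1) / qf x.1
            * alt_term k b (i + x.1 * 2) x.2.
pose G' (x : nat * nat) := if (x.2 <= x.1)%N then G (x.1 - x.2, x.2)%N else 0.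
have ordG x : fps_ord_ge (x.1 + x.2) (G x).
  apply: ord_geM; last exact: ord_alt_term.
  by apply: ord_geMr; apply: ord_geW _ (ord_geX p0); nia.
have sG : summable G.
  by apply: summable_natnat => x; apply: ord_geW (ordG x); lia.
have sG' : summable G'.
  apply: summable_natnat => -[s r] /=; rewrite /G'; case: leqP => //= rs.
  by apply: ord_geW (ordG _) => /=; lia.
transitivity (tsum G); last first.
  rewrite tsum_fubini //; apply: eq_tsum => j; rewrite -tsumZ //.
  exact: summable_alt_term.
transitivity (tsum G'); last first.
  pose h (x : nat * nat) := (x.1 + x.2, x.2)%N.
  rewrite -(@tsum_inj _ _ _ h) => [|[j r] [j' r'] /= [jr rr]|[s r]].
  - apply: eq_tsum => -[j r]; rewrite /G' /h /= leq_addl addnK //.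
  - by congr pair; lia.
  rewrite /G' /=; case: leqP => [rs _|]; last by rewrite eqxx.
  by exists (s - r, r)%N; rewrite /h /= subnK.
rewrite tsum_fubini //; apply: eq_tsum => s.
rewrite (@tsum_finite _ _ (iota 0 s.+1)) ?iota_uniq //; last first.
  by move=> r; rewrite mem_iota add0n ltnS /G' => /negPf /= ->.
rewrite -[iota 0 _]/(index_iota 0 s.+1) big_mkord /=.
(* Chosen so that (p; p)_(i+s) (z; p)_(s-r) = (p; p)_(i+2s-r), the numerator of
   [qratio (i + (s - r) * 2) r]. *)
pose z := p * p ^+ (i + s).
transitivity (p ^+ (k * (s * s + i * s) + b * s)
  * (1 - p ^+ ((k.+1 - b) * (i + s * 2 + 1))) * qratio i s
  * ((- z) ^+ s * p ^+ 'C(s, 2))).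
  rewrite /alt_term subSS (exprNn z) exprMn -exprM.
  rewrite (_ : k.+1 * (s * s + i * s) + 'C(s, 2) + b.+1 * s =
    k * (s * s + i * s) + b * s + s + (i + s) * s + 'C(s, 2))%N; last by nia.
  by rewrite !exprD; ring.
rewrite -sum_qbin_poch mulr_sumr; apply: eq_bigr => -[r /= rs] _.
rewrite ltnS in rs; rewrite /G' /= rs /G /= /alt_term.
have -> : qratio (i + (s - r) * 2) r =
    qf (i + s) * poch z p (s - r) / qf r.
  rewrite /qratio (_ : i + (s - r) * 2 + r = i + s + (s - r))%N; last by lia.
  by rewrite /qf pochD.
have E : (qf (s - r))^-1 / qf r = qbin p s r / qf s.
  by rewrite -invrM ?qfU // qbin_div.
rewrite (_ : i + (s - r) * 2 + r * 2 + 1 = i + s * 2 + 1)%N; last by lia.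
have E2 : p ^+ (k * ((s - r) * (s - r) + i * (s - r)) + b * (s - r)) *
  p ^+ (k * (r * r + (i + (s - r) * 2) * r) + 'C(r, 2) + b * r) =
  p ^+ (k * (s * s + i * s) + b * s) * p ^+ 'C(r, 2).
  rewrite -!exprD; congr (_ ^+ _).
  by move: (s - r)%N (subnK rs) => d <-; nia.
set x := p ^+ _ in E2 *; set y := p ^+ _ in E2 *.
set w := p ^+ _ in E2 *; set v := 1 - _.
transitivity ((x * y) * ((qf (s - r))^-1 / qf r)
  * ((-1) ^+ r * v * qf (i + s) * poch z p (s - r))).
  by rewrite E E2 /qratio; ring.
by ring.
Qed.

(** Half of the part of the original exponent that involves the j_k, hence an exponent of p =
    q^2. *)
Definition multi_exp m b i (j : {ffun 'I_m -> nat}) : nat :=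
  (\sum_(1 <= k < m.+1) Jsum j k ^ 2 + i * (\sum_(1 <= k < m.+1) Jsum j k)
   + \sum_((m + 2 - b)%N <= k < m.+1) Jsum j k)%N.

Definition multi_term m b i (j : {ffun 'I_m -> nat}) : {fps R} :=
  p ^+ multi_exp b i j / \prod_x qf (j x).

Definition multi_sum m b i := tsum (@multi_term m b i).

Lemma multi_exp_ge m b i (j : {ffun 'I_m -> nat}) x :
  (j x <= multi_exp b i j)%N.
Proof.
rewrite /multi_exp -addnA; apply: leq_trans (leq_addr _ _).
rewrite big_add1 big_mkord (bigD1 x) //=; apply: leq_trans (leq_addr _ _).
rewrite /Jsum (bigD1 x) //=; nia.
Qed.

Lemma ffun_box (m K : nat) : exists s : seq {ffun 'I_m -> nat},
  forall j : {ffun 'I_m -> nat}, (forall x, (j x <= K)%N) -> j \in s.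
Proof.
exists [seq [ffun x => val (f x)] | f : {ffun 'I_m -> 'I_K.+1}] => j jK.
apply/mapP; exists [ffun x => inord (j x)]; first by rewrite mem_enum.
by apply/ffunP => x; rewrite !ffunE /= inordK // ltnS.
Qed.

Lemma summable_multi_term m b i : summable (@multi_term m b i).
Proof.
apply: (@summable_ord _ _ (@multi_exp m b i)) => [k|j].
  have [s Hs] := ffun_box m k; exists s => j jk; apply: Hs => x.
  exact: leq_trans (multi_exp_ge _ _ _ _) jk.
by apply: ord_geMr; apply: ord_geX p0.
Qed.

Definition ffun_rcons m (x : nat * {ffun 'I_m -> nat}) : {ffun 'I_m.+1 -> nat} :=
  [ffun y => if unlift ord_max y is Some z then x.2 z else x.1].

Lemma ffun_rcons_bij m : bijective (@ffun_rcons m).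
Proof.
exists (fun f : {ffun 'I_m.+1 -> nat} =>
  (f ord_max, [ffun z : 'I_m => f (lift ord_max z)])) => [[a j]|f].
  congr pair; first by rewrite ffunE unlift_none.
  by apply/ffunP => z; rewrite !ffunE liftK.
apply/ffunP => y; rewrite !ffunE /=.
by case: unliftP => [z ->|-> //]; rewrite ffunE.
Qed.

Lemma ffun_rcons_widen m a (j : {ffun 'I_m -> nat}) z :
  ffun_rcons (a, j) (widen_ord (leqnSn m) z) = j z.
Proof.
rewrite ffunE (_ : widen_ord _ z = lift ord_max z) ?liftK //.
by apply: val_inj; rewrite /= /bump leqNgt ltn_ord.
Qed.

Lemma Jsum_rcons m a (j : {ffun 'I_m -> nat}) k : (k <= m.+1)%N ->
  Jsum (ffun_rcons (a, j)) k = (Jsum j k + a)%N.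
Proof.
move=> km; rewrite /Jsum big_mkcond big_ord_recr /= km ffunE unlift_none /=.
rewrite [in RHS]big_mkcond; congr (_ + _)%N; apply: eq_bigr => z _.
by rewrite ffun_rcons_widen.
Qed.

Lemma Jsum_out m (j : {ffun 'I_m -> nat}) : Jsum j m.+1 = 0%N.
Proof. by rewrite /Jsum big_pred0 // => x; rewrite ltnS leqNgt ltn_ord. Qed.

Lemma sum_Jsum_rcons m a (j : {ffun 'I_m -> nat}) c : (c <= m.+2)%N ->
  (\sum_(c <= k < m.+2) Jsum (ffun_rcons (a, j)) k
   = \sum_(c <= k < m.+1) Jsum j k + (m.+2 - c) * a)%N.
Proof.
move=> cm; rewrite (@eq_big_nat _ _ _ c m.+2 _ (fun k => Jsum j k + a)%N).
  rewrite big_split /= sum_nat_const_nat; congr (_ + _)%N.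
  move: cm; rewrite leq_eqVlt => /orP[/eqP->|cm]; first by rewrite !big_geq.
  by rewrite big_nat_recr //= Jsum_out addn0.
by move=> k /andP[_ km]; rewrite Jsum_rcons.
Qed.

Lemma sum_Jsum2_rcons m a (j : {ffun 'I_m -> nat}) :
  (\sum_(1 <= k < m.+2) Jsum (ffun_rcons (a, j)) k ^ 2
   = \sum_(1 <= k < m.+1) Jsum j k ^ 2
     + a * 2 * (\sum_(1 <= k < m.+1) Jsum j k) + m.+1 * a ^ 2)%N.
Proof.
rewrite (@eq_big_nat _ _ _ 1 m.+2 _
  (fun k => Jsum j k ^ 2 + a * 2 * Jsum j k + a ^ 2)%N).
  rewrite !big_split /= sum_nat_const_nat -big_distrr /=.
  by rewrite !(@big_nat_recr _ _ _ m.+1 1) //= Jsum_out !addn0 subn1.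
by move=> k /andP[_ km]; rewrite Jsum_rcons //; nia.
Qed.

(** Every J_k grows by [a]. Expanding the squares gives the cross term 2 a J_k, absorbed by
    replacing [i] with [i + a * 2]. The linear form for [b.+1] has [b] terms, the last of which is
    [a] alone. *)
Lemma multi_exp_rcons m b i a (j : {ffun 'I_m -> nat}) : (b <= m.+1)%N ->
  multi_exp b.+1 i (ffun_rcons (a, j)) =
  (m.+1 * (a * a + i * a) + b * a + multi_exp b (i + a * 2) j)%N.
Proof.
move=> bm; rewrite /multi_exp sum_Jsum2_rcons !sum_Jsum_rcons //; last by lia.
rewrite (_ : m.+1 + 2 - b.+1 = m + 2 - b)%N; last by lia.
rewrite (_ : m.+2 - (m + 2 - b) = b)%N; last by lia.
by rewrite subSS subn0; nia.
Qed.

Lemma multi_sum_rec m b i : (b <= m.+1)%N -> multi_sum m.+1 b.+1 i =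
  tsum (fun a => p ^+ (m.+1 * (a * a + i * a) + b * a) / qf a
                 * multi_sum m b (i + a * 2)).
Proof.
move=> bm; rewrite /multi_sum -(tsum_bij _ (@ffun_rcons_bij m)) tsum_fubini.
  apply: eq_tsum => a; rewrite -tsumZ; last exact: summable_multi_term.
  apply: eq_tsum => j; rewrite /multi_term multi_exp_rcons // exprD.
  rewrite big_ord_recr /= ffunE unlift_none /=.
  under eq_bigr do rewrite ffun_rcons_widen.
  rewrite invrM ?qfU //; first by ring.
  by apply: rpred_prod => x _; apply: qfU.
apply: summable_comp (@summable_multi_term _ _ _).
exact: bij_inj (@ffun_rcons_bij m).
Qed.

(** As [b] falls with [m], the base case meets only b = 0 and b = 1. For positive [m] the recursion
    produces only positive values of [b], so b = 0 is first traded for b = 1. *)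
Lemma multi_sumE m b i : (b <= m.+1)%N ->
  qpoch_oo [:: p] p * multi_sum m b i = alt_sum m.+1 b i.
Proof.
elim: m b i => [|m IHm] b i bm.
  have -> : multi_sum 0 b i = 1.
    rewrite /multi_sum (@tsum_finite _ _ [:: [ffun=> 0%N]]) //.
      rewrite big_seq1 /multi_term /multi_exp big_ord0 divr1.
      by rewrite !big_geq ?muln0 //; lia.
    by move=> j; rewrite inE => /eqP[]; apply/ffunP; case.
  rewrite mulr1 -(alt_sum11 i).
  by case: b bm => [|[|b]] // _; rewrite alt_sum_b0.
have recur c : (c <= m.+1)%N ->
    qpoch_oo [:: p] p * multi_sum m.+1 c.+1 i = alt_sum m.+2 c.+1 i.
  move=> cm; rewrite multi_sum_rec // alt_sum_rec // -tsumZ.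
    by apply: eq_tsum => a; rewrite mulrCA IHm.
  apply: summable_nat => a; do 2!apply: ord_geMr.
  by apply: ord_geW _ (ord_geX p0); nia.
case: b bm => [_|b bm]; last exact: recur.
rewrite alt_sum_b0 // -recur //; congr (_ * _); apply: eq_tsum => j.
rewrite /multi_term /multi_exp; congr (_ ^+ _ / _).
by rewrite (@big_geq _ _ _ (_ - 0)) ?(@big_geq _ _ _ (_ - 1)) //; lia.
Qed.

End MultiSum.

(** * The remaining double sum *)

Section SumSide.
Variables (R : comUnitRingType) (q : {fps R}).
Hypothesis q0 : fcoef q 0 = 0.

Let p := q ^+ 2.
Let p0 : fcoef p 0 = 0. Proof. by rewrite /p expr2 fcoef0M q0 mul0r. Qed.

Let qf := poch p p.
Let qfU n : qf n \is a GRing.unit. Proof. exact: poch_unit. Qed.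

Definition schur e := if e is 0%N then @schur0 _ p else @schur1 _ p.

(** This is (n+1-e) i^2 + (b-1+e) i, rewritten with i^2 - i = 2 C(i,2) so that no negative
    coefficient remains. *)
Definition lin_exp e n b i : nat :=
  (n * (i * i) + b * i + 'C(i, 2) * 2 * (1 - e))%N.

Definition schur_term e n b t : {fps R} :=
  q ^+ (n * (t * t) + b * t)
  * (1 - p ^+ ((2 * n + 2 - e - b) * (t + 1))) * schur e t.

Lemma lin_exp_ge e n b i : (0 < n)%N -> (i <= lin_exp e n b i)%N.
Proof. by rewrite /lin_exp; nia. Qed.

(** With t = i + 2 r and k = 2n + 1 - e, the exponent of q is n t^2 + b t plus 2 C(r,2) when e = 1,
    or 2 (C(t-r,2) + r^2) when e = 0. The quotient of Pochhammer symbols is the Gaussian binomial of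
    t - r and r. *)
Lemma lin_alt_sum e n b : (e <= 1)%N -> (0 < n)%N ->
  tsum (fun i => q ^+ lin_exp e n b i / qf i
                 * alt_sum p (2 * n - e).+1 b i)
  = tsum (schur_term e n b).
Proof.
move=> e1 n0; set k := (2 * n - e).+1.
have kE : (k + e = 2 * n + 1)%N by rewrite /k; lia.
have k0 : (0 < k)%N by [].
clearbody k.
pose G x := q ^+ lin_exp e n b x.1 / qf x.1 * alt_term p k b x.1 x.2.
pose G' (x : nat * nat) :=
  if (x.2 * 2 <= x.1)%N then G (x.1 - x.2 * 2, x.2)%N else 0.
have ordG x : fps_ord_ge (x.1 + x.2 * 2) (G x).
  apply: ord_geM.
    by apply: ord_geMr; apply: ord_geW _ (ord_geX q0); apply: lin_exp_ge.
  do 2!apply: ord_geMr; apply: ord_geMl; rewrite /p -exprM.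
  by apply: ord_geW _ (ord_geX q0); nia.
have sG : summable G.
  by apply: summable_natnat => x; apply: ord_geW (ordG x); lia.
have sG' : summable G'.
  apply: summable_natnat => -[s r] /=; rewrite /G'; case: leqP => //= rs.
  by apply: ord_geW (ordG _) => /=; lia.
transitivity (tsum G).
  rewrite tsum_fubini //; apply: eq_tsum => j; rewrite -tsumZ //.
  exact: summable_alt_term.
transitivity (tsum G').
  pose h (x : nat * nat) := (x.1 + x.2 * 2, x.2)%N.
  rewrite -(@tsum_inj _ _ _ h G') => [|[j r] [j' r'] /= [jr rr]|[s r]].
  - by apply: eq_tsum => -[j r]; rewrite /G' /h /= leq_addl addnK.
  - by congr pair; lia.
  rewrite /G' /=; case: leqP => [rs _|]; last by rewrite eqxx.
  by exists (s - r * 2, r)%N; rewrite /h /= subnK.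
rewrite tsum_fubini //; apply: eq_tsum => t.
rewrite (@tsum_finite _ _ (iota 0 t.+1)) ?iota_uniq //; last first.
  move=> r; rewrite mem_iota add0n ltnS /G' /= => tr.
  by rewrite ifN //; lia.
rewrite -[iota 0 _]/(index_iota 0 t.+1) big_mkord /=.
rewrite /schur_term (_ : schur e t = diag_sum p (fun r => (-1) ^+ r * p ^+
    (if e is 0%N then 'C(t - r, 2) + r * r else 'C(r, 2))%N) t);
  last by rewrite /schur; case: (e).
rewrite /diag_sum mulr_sumr; apply: eq_bigr => -[r /= rt] _; rewrite ltnS in rt.
rewrite /G' /=; case: leqP => rt2; last first.
  by rewrite qbin_small ?mulr0 //; lia.
have [i tE] : exists i, t = (i + r * 2)%N by exists (t - r * 2)%N; rewrite subnK.
rewrite tE addnK /G /= /alt_term /qratio -/qf.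
rewrite (_ : k.+1 - b = 2 * n + 2 - e - b)%N; last by lia.
rewrite (_ : i + r * 2 - r = i + r)%N; last by lia.
set v := 1 - _.
have -> : qbin p (i + r) r = qf (i + r) / qf i / qf r.
  apply: (mulIr (qfU i)); apply: (mulIr (qfU r)).
  rewrite [in RHS]mulrAC !divrK // -mulrA [qf i * _]mulrC addnC.
  exact: qbin_poch.
rewrite /p -!exprM.
have E : q ^+ lin_exp e n b i
    * q ^+ (2 * (k * (r * r + i * r) + 'C(r, 2) + b * r)) =
  q ^+ (n * ((i + r * 2) * (i + r * 2)) + b * (i + r * 2))
    * q ^+ (2 * (if e is 0%N then 'C(i + r, 2) + r * r else 'C(r, 2))).
  rewrite -!exprD; congr (_ ^+ _).
  have := bin2_double r; have := bin2_double i; have := bin2_double (i + r).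
  have [e01|e01] : e = 0%N \/ e = 1%N by lia.
    by rewrite e01 (_ : k = 2 * n + 1)%N /lin_exp; [nia|lia].
  by rewrite e01 (_ : k = 2 * n)%N /lin_exp; [nia|lia].
set x := q ^+ _ in E *; set y := q ^+ _ in E *.
set z := q ^+ _ in E *; set w := q ^+ _ in E *.
transitivity ((x * y) * ((-1) ^+ r * v * (qf (i + r) / qf i / qf r))).
  by ring.
by rewrite E; ring.
Qed.

Lemma ord_geXz k (z : int) : k%:Z <= z -> fps_ord_ge k (q ^ z).
Proof.
by case: z => // z kz; rewrite -exprnP; apply: ord_geW _ (ord_geX q0); lia.
Qed.

Definition quint_exp1 (d c : nat) (k : int) : int :=
  d%:Z * (3 * k ^+ 2 - k) + c%:Z * (3 * k ^+ 2 + 2 * k).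

Definition quint_exp2 (d c : nat) (k : int) : int :=
  d%:Z * (3 * k ^+ 2 + k) + c%:Z * (3 * k ^+ 2 + 4 * k + 1).

(** With x = q^c and Q = q^(2(c+d)) this is (-1)^k (Q^((3k^2-k)/2) x^(3k) + Q^((3k^2+k)/2)
    x^(3k+1)), the general term of the quintuple product series. *)
Definition quint_term (d c : nat) (k : int) : {fps R} :=
  (-1) ^+ `|k|%N * (q ^ quint_exp1 d c k + q ^ quint_exp2 d c k).

(** Each bracket is nonnegative at integers, the last being (3k+1)(k+1), so [c] and [d] may be
    lowered to 1. *)
Lemma quint_exp_ge (d c : nat) (k : int) : (0 < d)%N -> (0 < c)%N ->
  `|k| <= quint_exp1 d c k /\ `|k| <= quint_exp2 d c k.
Proof.
rewrite /quint_exp1 /quint_exp2 => d0 c0.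
have k2 : `|k| <= k ^+ 2 by rewrite expr2; nia.
have {d0} : 1 <= d%:Z by lia.
have {c0} : 1 <= c%:Z by lia.
move: (c%:Z) (d%:Z) => C D C1 D1.
have mulle (x y : int) : 1 <= x -> 0 <= y -> y <= x * y by nia.
split.
  apply: le_trans (_ : _ <= 3 * k ^+ 2 - k + (3 * k ^+ 2 + 2 * k)) _.
    by lia.
  by apply: lerD; apply: mulle => //; lia.
have k3 : 0 <= 3 * k ^+ 2 + 4 * k + 1 by rewrite expr2; nia.
apply: le_trans (_ : _ <= 3 * k ^+ 2 + k + (3 * k ^+ 2 + 4 * k + 1)) _.
  by case: (ltrP k 0) => ?; lia.
by apply: lerD; apply: mulle => //; lia.
Qed.

Lemma summable_quint_term d c : (0 < d)%N -> (0 < c)%N ->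
  summable (quint_term d c).
Proof.
move=> d0 c0; apply: summable_int => k; apply: ord_geMl.
have [k1 k2] := quint_exp_ge k d0 c0.
by apply: ord_geD; apply: ord_geXz; rewrite abszE.
Qed.

Lemma schurE e u : (e <= 1)%N ->
  [/\ schur e (3 * u) = (-1) ^+ u * q ^+ ((2 - e) * ('C(u, 2) * 6 + u * 2)),
      schur e (3 * u + 1) = (-1) ^+ u * q ^+ ((2 - e) * ('C(u, 2) * 6 + u * 4))
    & schur e (3 * u + 2) = 0].
Proof.
case: e => [|[|//]] _; rewrite /schur.
  have [-> -> ->] := schur0E p u; rewrite /p -!exprM.
  by split=> //; congr (_ * _ ^+ _); lia.
have [-> -> ->] := schur1E p u; rewrite /p -!exprM.
by split=> //; congr (_ * _ ^+ _); lia.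
Qed.

(** For fixed u, t = 3u and t = 3u+1 give four monomials. The two without the factor p^(a(t+1)) form
    the term k = u; the other two, in exchanged order, form the term k = -u-1, whose opposite sign
    is the minus in [1 - p ^+ _]. *)
Lemma schur_sum e n b : (e <= 1)%N -> (0 < n)%N -> (b <= 2 * n + 1 - e)%N ->
  tsum (schur_term e n b) = tsum (quint_term (2 * n + 2 - e - b) (n + b)).
Proof.
move=> e1 n0 bn.
rewrite tsum_int; last by apply: summable_quint_term; lia.
rewrite tsum_mod3; last first.
  apply: summable_nat => t; do 2!apply: ord_geMr.
  by apply: ord_geW _ (ord_geX q0); nia.
apply: eq_tsum => u; rewrite /schur_term /quint_term.
have [-> -> ->] := schurE u e1; rewrite mulr0 addr0 [absz (Negz u)]/= [absz u%:Z]/=.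
set a := (2 * n + 2 - e - b)%N.
have aE : a%:Z = 2 * n%:Z + 2 - e%:Z - b%:Z by rewrite /a; lia.
clearbody a.
have uE : 'C(u, 2)%:Z * 6 = 3 * (u%:Z ^+ 2 - u%:Z).
  by have := bin2_double u; rewrite expr2; lia.
have eE : (2 - e)%N%:Z = 2 - e%:Z by lia.
pose s := (n * (3 * u * (3 * u)) + b * (3 * u)
  + (2 - e) * ('C(u, 2) * 6 + u * 2))%N.
pose s' := (n * ((3 * u + 1) * (3 * u + 1)) + b * (3 * u + 1)
  + (2 - e) * ('C(u, 2) * 6 + u * 4))%N.
have -> : quint_exp1 a (n + b) u%:Z = s%:Z.
  by rewrite /s /quint_exp1 !(PoszD, PoszM) eE aE uE; ring.
have -> : quint_exp2 a (n + b) u%:Z = s'%:Z.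
  by rewrite /s' /quint_exp2 !(PoszD, PoszM) eE aE uE; ring.
have -> : quint_exp1 a (n + b) (Negz u) = (s' + 2 * (a * (3 * u + 1 + 1)))%N%:Z.
  by rewrite /s' /quint_exp1 NegzE -addn1 !(PoszD, PoszM) eE aE uE; ring.
have -> : quint_exp2 a (n + b) (Negz u) = (s + 2 * (a * (3 * u + 1)))%N%:Z.
  by rewrite /s /quint_exp2 NegzE -addn1 !(PoszD, PoszM) eE aE uE; ring.
rewrite -!exprnP /p -!exprM /s /s' !(exprD q) (exprS (-1)).
by ring.
Qed.

End SumSide.

(** * Triple and quintuple products *)

Lemma sign_abszS (R : pzRingType) (k : int) :
  (-1) ^+ `|(k + 1)%R|%N = - (-1) ^+ `|k|%N :> R.
Proof.
case: k => k; first by rewrite -PoszD /= addn1 exprS mulN1r.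
rewrite NegzE (_ : - k.+1%:Z + 1 = - k%:Z) ?abszN /= ?exprS; last by lia.
by rewrite mulN1r opprK.
Qed.

Section TripleProduct.
Variables (R : comUnitRingType) (q : {fps R}).
Hypothesis q0 : fcoef q 0 = 0.
Variables (a : nat) (b : int).
Hypothesis ba : `|b| < a%:Z.

Let Q := q ^+ (2 * a).

Let Q0 : fcoef Q 0 = 0.
Proof. by apply: (ord_geX q0); lia. Qed.

(** Since |b| <= a - 1 and |k| <= k^2, the form is at least a k^2 - (a-1) |k| >= |k|. *)
Lemma theta_exp_ge (k : int) : `|k| <= a%:Z * k ^+ 2 + b * k.
Proof.
have k2 : `|k| <= k ^+ 2 by rewrite expr2; nia.
have : 0 <= (a%:Z - `|b|) * `|k| - `|k| by nia.
have : 0 <= a%:Z * (k ^+ 2 - `|k|) by apply: mulr_ge0; lia.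
have : - (`|b| * `|k|) <= b * k by rewrite -normrM; lia.
by nia.
Qed.

Definition theta_term (k : int) : {fps R} :=
  (-1) ^+ `|k|%N * q ^ (a%:Z * k ^+ 2 + b * k).

Lemma ord_theta_term k : fps_ord_ge `|k|%N (theta_term k).
Proof.
by apply: ord_geMl; apply: ord_geXz => //; rewrite abszE theta_exp_ge.
Qed.

Lemma summable_theta_term : summable theta_term.
Proof. exact: summable_int ord_theta_term. Qed.

Let y := q ^ (a%:Z + b).
Let w := q ^ (a%:Z - b).

Let QX n : Q ^+ n = q ^ (2 * a%:Z * n%:Z).
Proof. by rewrite /Q -exprM exprnP. Qed.

(** A finite triple product. Its factors are added one at a time, those of [w] by one Pascal rule
    and those of [y] by the other, so that only nonnegative powers of q are ever multiplied. *)
Lemma theta_fin A B : poch y Q A * poch w Q B =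
  \sum_(j < (A + B).+1) theta_term (j%:Z - B%:Z) * qbin Q (A + B) j.
Proof.
have T0 k : 0 <= a%:Z * k ^+ 2 + b * k.
  exact: le_trans (normr_ge0 _) (theta_exp_ge k).
have mulz (z1 z2 : int) : 0 <= z1 -> 0 <= z2 -> q ^ z1 * q ^ z2 = q ^ (z1 + z2).
  by move=> h1 h2; rewrite exprzD_ss // h1 h2.
elim: A => [|A IHA].
  elim: B => [|B IHB].
    rewrite !poch0 big_ord1 /= mulr1 /theta_term subrr /= expr0 mul1r.
    by rewrite expr0n mulr0 mulr0 addr0 expr0z mulr1.
  rewrite pochS mulrA IHB !add0n mulr_suml
    (sum_qbinS (fun j => theta_term (j%:Z - B.+1%:Z))); apply: eq_bigr => j _.
  rewrite mulrAC; congr (_ * _).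
  rewrite (_ : j.+1%:Z - B.+1%:Z = j%:Z - B%:Z); last by lia.
  rewrite mulrBr mulr1 addrC; congr (_ + _).
  rewrite /theta_term (_ : j%:Z - B%:Z = j%:Z - B.+1%:Z + 1); last by lia.
  rewrite sign_abszS !mulNr opprK -!mulrA; congr (_ * _); rewrite !QX !mulz //; try lia.
    by congr (_ ^ _); rewrite (_ : B.+1%:Z = B%:Z + 1); [ring|lia].
rewrite pochS mulrAC IHA mulr_suml addSn
  (sum_qbinSr (fun j => theta_term (j%:Z - B%:Z))); apply: eq_bigr => j _.
rewrite mulrAC; congr (_ * _).
rewrite (_ : j.+1%:Z - B%:Z = j%:Z - B%:Z + 1); last by lia.
have jAB : (j <= A + B)%N by rewrite -ltnS.
rewrite mulrBr mulr1; congr (_ + _); rewrite /theta_term sign_abszS mulNr !mulrN -mulrA.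
congr (- _); rewrite [RHS]mulrCA; congr (_ * _); rewrite !QX !mulz //; try lia.
  congr (_ ^ _); rewrite -subzn // PoszD; ring.
Qed.

Lemma ord_ge_qbin n N j : (n <= j)%N -> (j + n <= N)%N ->
  fps_ord_ge n (qpoch_oo [:: Q] Q * qbin Q N j - 1).
Proof.
move=> nj jN; have jN' : (j <= N)%N by lia.
have U : qpoch_oo [:: Q] Q \is a GRing.unit.
  by apply: qpoch_oo_unit => //=; rewrite Q0 eqxx.
apply: (ord_ge_mulI U); rewrite mulr1.
have P m : (n <= m)%N -> fps_ord_ge n (poch Q Q m - qpoch_oo [:: Q] Q).
  by move=> nm; apply: ord_ge_poch.
apply: ord_ge_trans (P N _); last by lia.
rewrite -{2}(subnKC jN') -qbin_poch subnKC //.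
rewrite [qpoch_oo _ _ * qbin _ _ _]mulrC mulrCA.
apply: ord_ge_congM; first by rewrite subrr; apply: ord_ge0.
by apply: ord_ge_congM; apply: ord_ge_sym; apply: P; lia.
Qed.

Theorem triple_product :
  qpoch_oo [:: Q] Q * (qpoch_oo [:: y] Q * qpoch_oo [:: w] Q)
  = tsum theta_term.
Proof.
(* With N = 2n, each j between 0 and 2N either has |j - N| >= n, where the theta term is negligible,
   or stays at distance at least n from both ends, where the binomial times (Q; Q)_oo is congruent
   to 1. *)
apply: ord_ge_eq => n; pose N := (n + n)%N.
pose s := [seq j%:Z - N%:Z | j <- iota 0 (N + N).+1].
have us : uniq s.
  by rewrite map_inj_uniq ?iota_uniq // => i j; lia.
apply: ord_ge_trans (ord_ge_sym (ord_ge_tsum_fin summable_theta_term us _)).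
  rewrite big_map -[iota 0 _]/(index_iota 0 (N + N).+1) big_mkord.
  apply: (@ord_ge_trans _ _ _ (qpoch_oo [:: Q] Q * (poch y Q N * poch w Q N))).
    apply: ord_ge_congM; first by rewrite subrr; apply: ord_ge0.
    by apply: ord_ge_congM; apply: ord_ge_sym; apply: ord_ge_poch => //;
      rewrite /N; lia.
  rewrite theta_fin mulr_sumr -sumrB; apply: ord_ge_sum => j _.
  rewrite mulrCA -[X in _ - X]mulr1 -mulrBr.
  have [jn|nj] := leqP n `|(j%:Z - N%:Z)%R|%N.
    by apply: ord_geMr; refine (ord_geW jn _); exact: ord_theta_term.
  by apply: ord_geMl; apply: (@ord_ge_qbin n); move: nj; rewrite /N; lia.
move=> k ks; refine (ord_geW _ (@ord_theta_term k)).
rewrite leqNgt; apply: contra ks => kn; apply/mapP.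
exists `|(k + N%:Z)%R|%N; last by rewrite /N in kn *; lia.
by rewrite mem_iota /N; lia.
Qed.

End TripleProduct.

Section Quintuple.
Variables (R : comUnitRingType) (q : {fps R}).
Hypothesis q0 : fcoef q 0 = 0.
Implicit Types x z : int.

Definition signed_pow x z : {fps R} := (-1) ^+ `|x|%N * q ^ z.

Lemma signed_powS x z : signed_pow (x + 1) z = - signed_pow x z.
Proof. by rewrite /signed_pow sign_abszS mulNr. Qed.

Lemma sign_abszD x y :
  (-1) ^+ `|(x + y)%R|%N = (-1) ^+ `|x|%N * (-1) ^+ `|y|%N :> {fps R}.
Proof.
rewrite -exprD -signr_odd -[RHS]signr_odd; congr (_ ^+ _).
by congr nat_of_bool; lia.
Qed.

Lemma signed_pow_even x y z : signed_pow (x + 2 * y) z = signed_pow x z.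
Proof.
rewrite /signed_pow sign_abszD (_ : 2 * y = y + y) ?sign_abszD; last by lia.
by rewrite -expr2 -exprM mulnC exprM sqrrN expr1n expr1n mulr1.
Qed.

(** The argument [y] witnesses that the signs agree, which reduces a change of variables to two
    polynomial identities over the integers. *)
Lemma eq_signed_pow y x x' z z' : x = x' + 2 * y -> z = z' ->
  signed_pow x z = signed_pow x' z'.
Proof. by move=> -> ->; rewrite signed_pow_even. Qed.

Lemma signed_powM x x' z z' : 0 <= z -> 0 <= z' ->
  signed_pow x z * signed_pow x' z' = signed_pow (x + x') (z + z').
Proof.
move=> z0 z0'; rewrite /signed_pow sign_abszD exprzD_ss; last by rewrite z0 z0'.
by rewrite mulrACA.
Qed.

Lemma tsum_parity (F : int * int -> {fps R}) : summable F ->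
  tsum F = tsum (fun u => F (u.2 + 2 * u.1, u.2))
         + tsum (fun u => F (u.2 + 2 * u.1 + 1, u.2)).
Proof.
pose h (u : (int * int) * bool) := (u.1.2 + 2 * u.1.1 + u.2%:Z, u.1.2).
move=> sF; rewrite (@tsum_split _ _ _ _ h) //.
  rewrite -tsumD; first by apply: eq_tsum => -[s k]; rewrite big_bool addrC /h /= addr0.
    by apply: summable_comp sF => -[s k] [s' k'] /= [? ?]; congr pair; lia.
  by apply: summable_comp sF => -[s k] [s' k'] /= [? ?]; congr pair; lia.
exists (fun u : int * int =>
  (((u.1 - u.2) %/ 2)%Z, u.2, ((u.1 - u.2) %% 2)%Z == 1)) => [[[s k] e]|[m k]].
  by rewrite /h /=; congr (_, _, _); case: e; lia.
by rewrite /h /=; congr pair; case: eqP; lia.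
Qed.

Variables d c : nat.
Hypotheses (d0 : (0 < d)%N) (c0 : (0 < c)%N).

Let A := (c + d)%N.
Let Q := q ^+ (2 * A).
Let Q0 : fcoef Q 0 = 0.
Proof. by apply: (ord_geX q0); rewrite /A; lia. Qed.

(** The two monomials of the r-th term of [alt_sum11] at i = 0 are the terms r and -r-1 of the theta
    series. *)
Lemma pentagonal : qpoch_oo [:: Q] Q = tsum (theta_term q (3 * A) A%:Z).
Proof.
rewrite -(alt_sum11 Q0 0) tsum_int; last by apply: summable_theta_term => //; lia.
apply: eq_tsum => r; rewrite /alt_term /qratio add0n mulrV ?mulr1; last first.
  exact: poch_unit.
rewrite /theta_term [absz (Negz r)]/= [absz r%:Z]/=.
pose s := (A * (3 * (r * r) + r))%N.
have sE : (2 * A * (1 * (r * r + 0 * r) + 'C(r, 2) + 1 * r) = s)%N.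
  rewrite (mulnC 2) -mulnA; congr (_ * _)%N.
  by have := bin2_double r; lia.
have -> : (3 * A)%N%:Z * r%:Z ^+ 2 + A%:Z * r%:Z = s%:Z.
  by rewrite /s !(PoszD, PoszM); ring.
have -> : (3 * A)%N%:Z * Negz r ^+ 2 + A%:Z * Negz r =
    (s + 2 * A * (r * 2 + 1))%N%:Z.
  rewrite /s NegzE (_ : r.+1%:Z = r%:Z + 1); last by lia.
  by rewrite !(PoszD, PoszM); ring.
rewrite subSS subn0 (mul1n (r * 2 + 1)) -!exprnP (exprD q) /Q -!exprM sE (exprS (-1)).
by ring.
Qed.

(* Both sides are double sums over the lattice Z^2 of q to a shifted multiple of
   the form m^2 + 3 k^2, whose isometries (m, k) -> ((+- m + 3 k) / 2, (m +- k) / 2)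
   are integral when m and k have the same parity. Affine versions of them carry
   T1 (m + k even) and T2 (m + k odd) onto the two halves of G, and the rest of
   T2 onto the opposite of the rest of T1. *)
Lemma quintuple : qpoch_oo [:: Q] Q * tsum (theta_term q A (c%:Z - d%:Z))
  = tsum (theta_term q A (- d%:Z)) * tsum (quint_term q d c).
Proof.
have AE : A%:Z = c%:Z + d%:Z by [].
have A3E : (3 * A)%N%:Z = 3 * (c%:Z + d%:Z) by [].
pose E a b (k : int) : int := a%:Z * k ^+ 2 + b * k.
pose G (u : int * int) :=
  signed_pow (u.1 + u.2) (E A (c%:Z - d%:Z) u.1 + E (3 * A)%N A%:Z u.2).
pose T1 (u : int * int) :=
  signed_pow (u.1 + u.2) (E A (- d%:Z) u.1 + quint_exp1 d c u.2).
pose T2 (u : int * int) :=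
  signed_pow (u.1 + u.2) (E A (- d%:Z) u.1 + quint_exp2 d c u.2).
have bG : `|c%:Z - d%:Z| < A%:Z by rewrite /A; lia.
have bT : `|- d%:Z| < A%:Z by rewrite /A; lia.
have bP : `|A%:Z| < (3 * A)%N%:Z by rewrite /A; lia.
have sP := summable_theta_term q0 bP.
have sG0 := summable_theta_term q0 bG.
have sT0 := summable_theta_term q0 bT.
have E0 a b k : `|b| < a%:Z -> 0 <= E a b k.
  by move=> ba; exact: le_trans (normr_ge0 k) (theta_exp_ge ba k).
have [q1 q2] : (forall k, `|k| <= quint_exp1 d c k) /\
               (forall k, `|k| <= quint_exp2 d c k).
  by split=> k; have [] := quint_exp_ge k d0 c0.
have s1 : summable (fun k => signed_pow k (quint_exp1 d c k)).
  by apply: summable_int => k; apply: ord_geMl; apply: ord_geXz; rewrite // abszE.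
have s2 : summable (fun k => signed_pow k (quint_exp2 d c k)).
  by apply: summable_int => k; apply: ord_geMl; apply: ord_geXz; rewrite // abszE.
have GE : tsum (theta_term q A (c%:Z - d%:Z)) * tsum (theta_term q (3 * A) A%:Z)
    = tsum G.
  rewrite tsumM //; apply: eq_tsum => -[j n].
  by rewrite /theta_term -!/(signed_pow _ _) signed_powM //; apply: E0.
have T1E : tsum (theta_term q A (- d%:Z)) *
    tsum (fun k => signed_pow k (quint_exp1 d c k)) = tsum T1.
  rewrite tsumM //; apply: eq_tsum => -[m k] /=.
  rewrite /theta_term -!/(signed_pow _ _) signed_powM //; first exact: E0.
  exact: le_trans (q1 k).
have T2E : tsum (theta_term q A (- d%:Z)) *
    tsum (fun k => signed_pow k (quint_exp2 d c k)) = tsum T2.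
  rewrite tsumM //; apply: eq_tsum => -[m k] /=.
  rewrite /theta_term -!/(signed_pow _ _) signed_powM //; first exact: E0.
  exact: le_trans (q2 k).
have sG : summable G.
  apply: eq_summable (summableM sG0 sP) => -[j n] /=.
  by rewrite /theta_term -!/(signed_pow _ _) signed_powM //; apply: E0.
have sT1 : summable T1.
  apply: eq_summable (summableM sT0 s1) => -[m k] /=.
  rewrite /theta_term -!/(signed_pow _ _) signed_powM //; first exact: E0.
  exact: le_trans (q1 k).
have sT2 : summable T2.
  apply: eq_summable (summableM sT0 s2) => -[m k] /=.
  rewrite /theta_term -!/(signed_pow _ _) signed_powM //; first exact: E0.
  exact: le_trans (q2 k).
rewrite pentagonal mulrC GE.
have -> : tsum (quint_term q d c) =
    tsum (fun k => signed_pow k (quint_exp1 d c k))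
  + tsum (fun k => signed_pow k (quint_exp2 d c k)).
  rewrite -tsumD //; apply: eq_tsum => k.
  by rewrite /quint_term mulrDr.
rewrite mulrDr T1E T2E (tsum_parity sT1) (tsum_parity sT2) (tsum_parity sG).
have e1 : tsum (fun u => T1 (u.2 + 2 * u.1, u.2)) =
          tsum (fun u => G (u.2 + 2 * u.1, u.2)).
  (* With m = k + 2 s this is (m, k) -> ((m + 3k)/2, (k - m)/2), which preserves m^2 + 3 k^2. *)
  pose h (u : int * int) := (u.2 + u.1, - u.1).
  have hB : bijective h.
    by exists (fun u => (- u.2, u.1 + u.2)) => -[s k]; rewrite /h /=; congr pair; lia.
  rewrite -(tsum_bij (fun u => G (u.2 + 2 * u.1, u.2)) hB).
  apply: eq_tsum => -[s k]; rewrite /T1 /G /h /=.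
  by apply: (@eq_signed_pow s); rewrite /E /quint_exp1 ?A3E ?AE; ring.
have e2 : tsum (fun u => T2 (u.2 + 2 * u.1 + 1, u.2)) =
          tsum (fun u => G (u.2 + 2 * u.1 + 1, u.2)).
  pose h (u : int * int) := (u.2, u.1).
  have hB : bijective h by exists h => -[].
  rewrite -(tsum_bij (fun u => G (u.2 + 2 * u.1 + 1, u.2)) hB).
  apply: eq_tsum => -[s k]; rewrite /T2 /G /h /=.
  by apply: (@eq_signed_pow 0); rewrite /E /quint_exp2 ?A3E ?AE; ring.
have e3 : tsum (fun u => T2 (u.2 + 2 * u.1, u.2)) =
          - tsum (fun u => T1 (u.2 + 2 * u.1 + 1, u.2)).
  pose h (u : int * int) := (- u.1, u.2 + u.1).
  have hB : bijective h.
    by exists (fun u => (- u.1, u.2 + u.1)) => -[s k]; rewrite /h /=; congr pair; lia.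
  rewrite -(tsum_bij (fun u => T1 (u.2 + 2 * u.1 + 1, u.2)) hB) -tsumN.
    apply: eq_tsum => -[s k]; rewrite /T2 /T1 /h /= -signed_powS.
    by apply: (@eq_signed_pow (s - 1)); rewrite /E /quint_exp1 /quint_exp2 ?AE; ring.
  apply: summable_comp sT1 => -[s k] [s' k'] /= [? ?]; congr pair; lia.
by rewrite e1 e2 e3; ring.
Qed.

End Quintuple.

Section Quotient.
Variables (R : comUnitRingType) (q : {fps R}).
Hypothesis q0 : fcoef q 0 = 0.
Variables d c : nat.
Hypotheses (d0 : (0 < d)%N) (c0 : (0 < c)%N).

Let Q := q ^+ (2 * (c + d)).

(** Both theta series in [quintuple] are triple products to the base [Q]: the linear coefficient c -
    d gives the parameters q^(2c), q^(2d), and -d gives q^c, q^(c+2d). A common factor (Q; Q)_oo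
    then cancels. *)
Lemma quintuple_product : tsum (quint_term q d c) =
  qpoch_oo [:: Q] Q * (qpoch_oo [:: q ^+ (2 * c); q ^+ (2 * d)] Q
                       / qpoch_oo [:: q ^+ c; q ^+ (c + 2 * d)] Q).
Proof.
have X0 n : (0 < n)%N -> fcoef (q ^+ n) 0 = 0 by move=> n0; apply: (ord_geX q0).
have U s : all (fun n => 0 < n)%N s ->
    qpoch_oo [seq q ^+ n | n <- s] Q \is a GRing.unit.
  move=> /allP s0; apply: qpoch_oo_unit; first by apply: X0; lia.
  by apply/allP => _ /mapP[n /s0 n0 ->]; rewrite X0.
have U1 : qpoch_oo [:: Q] Q \is a GRing.unit.
  by apply: (U [:: 2 * (c + d)]%N) => /=; lia.
have U2 : qpoch_oo [:: q ^+ c; q ^+ (c + 2 * d)] Q \is a GRing.unit.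
  by apply: (U [:: c; c + 2 * d]%N) => /=; lia.
have := quintuple q0 d0 c0; rewrite -!triple_product //; try by lia.
have -> : q ^ ((c + d)%N%:Z + (c%:Z - d%:Z)) = q ^+ (2 * c).
  by rewrite exprnP; congr (_ ^ _); lia.
have -> : q ^ ((c + d)%N%:Z - (c%:Z - d%:Z)) = q ^+ (2 * d).
  by rewrite exprnP; congr (_ ^ _); lia.
have -> : q ^ ((c + d)%N%:Z + - d%:Z) = q ^+ c.
  by rewrite exprnP; congr (_ ^ _); lia.
have -> : q ^ ((c + d)%N%:Z - - d%:Z) = q ^+ (c + 2 * d).
  by rewrite exprnP; congr (_ ^ _); lia.
rewrite -/Q -!qpoch_oo2 -[RHS]mulrA => /(mulrI U1) E.
by rewrite mulrA E mulrAC mulrV ?mul1r.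
Qed.

End Quotient.

(** * Factoring the summand and assembling the identity *)

Lemma qtermE n e b m i (j : {ffun 'I_m -> nat}) : (1 <= n)%N -> (e <= 1)%N ->
  qterm n e b (i, j) = 'q ^+ lin_exp e n b i / poch ('q ^+ 2) ('q ^+ 2) i
                       * multi_term ('q ^+ 2) b i j.
Proof.
move=> n1 e1; rewrite /qterm /multi_term.
under [\prod_(p < m) _]eq_bigr do rewrite qpochE.
have U k : poch ('q ^+ 2) ('q ^+ 2) k \is a GRing.unit.
  by apply: poch_unit; apply: (@ord_geX _ 2 (fpsX int)) => //.
rewrite qpochE invrM //; last by apply: rpred_prod => x _; apply: U.
have -> : Qexp n e i j + Rexp b e i j =
    (lin_exp e n b i + 2 * multi_exp b i j)%N%:Z.
  rewrite /Qexp /Rexp /lin_exp /multi_exp.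
  have e2 : (1 - e)%N%:Z = 1 - e%:Z by lia.
  have iE : 2 * 'C(i, 2)%:Z = i%:Z ^+ 2 - i%:Z.
    by have := bin2_double i; rewrite expr2; lia.
  have JE : (\sum_(1 <= k < m.+1) Jsum j k ^ 2)%N%:Z =
      \sum_(1 <= k < m.+1) (Jsum j k)%:Z ^+ 2.
    rewrite (big_morph Posz PoszD (erefl _)); apply: eq_bigr => k _.
    by rewrite -mulnn PoszM expr2.
  rewrite !(PoszD, PoszM) JE !(big_morph Posz PoszD (erefl _)) e2.
  by rewrite ['C(i, 2)%:Z * 2]mulrC iE; ring.
by rewrite -exprnP exprD exprM; ring.
Qed.

Lemma summable_qterm n e b m : (1 <= n)%N -> (e <= 1)%N ->
  summable (@qterm n e b m).
Proof.
move=> n1 e1.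
pose w (x : nat * {ffun 'I_m -> nat}) := (lin_exp e n b x.1 + multi_exp b x.1 x.2)%N.
apply: (@summable_ord _ _ w) => [k|[i j]].
  have [s Hs] := ffun_box m k.
  exists [seq (i, j) | i <- iota 0 k.+1, j <- s] => -[i j] wk.
  apply: (allpairs_f pair); last apply: Hs => x.
    rewrite mem_iota add0n ltnS; apply: leq_trans wk; apply: leq_trans (leq_addr _ _).
    exact: lin_exp_ge.
  apply: leq_trans wk; apply: leq_trans (leq_addl _ _); exact: multi_exp_ge.
rewrite qtermE //; apply: ord_geM; apply: ord_geMr; first exact: ord_geX.
by apply: ord_geX; apply: (@ord_geX _ 2 (fpsX int)).
Qed.

Theorem theorem1p2 (e n b : nat) (he : (e <= 1)%N) (hn : (1 <= n)%N)
    (hb : (b <= 2 * n + 1 - e)%N) :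
  let m := (2 * n - e)%N in
  let l := (3 * n + 1 - e)%N in
  fps_has_sum (@qterm n e b m) (chi_A2odd l (n + b)).
Proof.
move=> m l; have sq := @summable_qterm n e b m hn he.
suff <- : tsum (@qterm n e b m) = chi_A2odd l (n + b) by exact: summable_has_sum.
have q0 : fcoef 'q 0 = 0 by [].
set p := 'q ^+ 2; have p0 : fcoef p 0 = 0 by exact: (ord_geX q0).
have U : qpoch_oo [:: p] p \is a GRing.unit.
  by apply: qpoch_oo_unit => //; rewrite all_seq1 p0 eqxx.
apply: (mulrI U).
(* Here c = n + b and d = 2n + 2 - e - b, so c + d = l + 1 and the base of the products is q^(2l+2).
   The bound on [b] makes d positive. *)
transitivity (tsum (quint_term 'q (2 * n + 2 - e - b) (n + b))).
  rewrite -schur_sum // -lin_alt_sum // tsum_fubini // -tsumZ; last first.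
    exact: summable_fubini.
  apply: eq_tsum => i; rewrite -multi_sumE; [|by []|by lia].
  rewrite [RHS]mulrCA; congr (_ * _); rewrite /multi_sum -tsumZ.
    by apply: eq_tsum => j; apply: qtermE.
  exact: summable_multi_term p0 _ _ _.
rewrite quintuple_product //; try by lia.
have cancel (x y z : {fps int}) : x \is a GRing.unit -> x * (y / x * z) = y * z.
  by move=> ux; rewrite !mulrA [x * y]mulrC mulrK.
rewrite /chi_A2odd [RHS](cancel _ _ _ U).
rewrite (_ : 2 * (n + b + (2 * n + 2 - e - b)) = 2 * l + 2)%N; last by lia.
rewrite (_ : 2 * l + 2 - 2 * (n + b) = 2 * (2 * n + 2 - e - b))%N; last by lia.
by rewrite (_ : 2 * l + 2 - (n + b) = n + b + 2 * (2 * n + 2 - e - b))%N; last by lia.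
Qed.
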